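(* Let $n\ge 3$ and $k\ge 1$ be integers, let $K$ be a field containing $n$ distinct $n$-th roots of $1$, let $R=K[x,y,z]$, put $f=y^n-z^n$, $g=z^n-x^n$, $h=x^n-y^n$, and let $I=(xf,yg,zh)$. Then $$\begin{aligned} I^{(kn)} = {}& (fgh)^k\cdot (f,g)^{(n-3)k} \\ &+\sum_{i=1}^k f^{(k-i)(n-2)+2i}\,g^{k+i(n-3)}\,h^{k-i}\,x^{(i-1)n+1}\cdot (x,y)^{n-1}\\ &+\sum_{i=1}^k f^{k-i}\,g^{(k-i)(n-2)+2i}\,h^{k+i(n-3)}\,y^{(i-1)n+1}\cdot (y,z)^{n-1}\\ &+\sum_{i=1}^k f^{k+i(n-3)}\,g^{k-i}\,h^{(k-i)(n-2)+2i}\,z^{(i-1)n+1}\cdot (z,x)^{n-1},\end{aligned}$$ and the generators displayed on the right-hand side form a minimal generating set of $I^{(kn)}$.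
   Context: For $m\ge 1$, $I^{(m)}$ denotes the $m$-th symbolic power of $I$: $I^{(m)}=\bigcap_{\mathfrak p\in \mathrm{Ass}(R/I)}(I^mR_{\mathfrak p}\cap R)$; for this ideal it is equivalently $(x^n-y^n,y^n-z^n)^m\cap(x,y)^m\cap(y,z)^m\cap(z,x)^m$. The generators displayed are the obvious ones: each power $(a,b)^s$ of a two-generated ideal is generated by the $s+1$ products $a^{s-j}b^{j}$, $0\le j\le s$, and these are multiplied by the displayed prefactors. *)

(* Defs.v *)
From HB Require Import structures.
From mathcomp Require Import all_boot all_order all_algebra.
From mathcomp Require Import mpoly.

Set Implicit Arguments.
Unset Strict Implicit.
Unset Printing Implicit Defensive.

Import GRing.Theory.
Local Open Scope ring_scope.

(* Ideals are Prop-valued predicates: membership in a finitely generated ideal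
   of {mpoly K[3]} is not a boolean function in the libraries.  Two ideals are
   compared by [ideal_eq]. *)
Definition ideal_eq (R : comNzRingType) (A B : R -> Prop) : Prop :=
  forall r, A r <-> B r.

Definition is_ideal (R : comNzRingType) (A : R -> Prop) : Prop :=
  [/\ A 0, forall r s, A r -> A s -> A (r + s)
    & forall c r, A r -> A (c * r)].

Definition ideal_gen (R : comNzRingType) (S : R -> Prop) : R -> Prop :=
  fun r => exists t : seq (R * R),
    (forall c, c \in t -> S c.2) /\ r = \sum_(c <- t) c.1 * c.2.

Definition ideal_of_seq (R : comNzRingType) (G : seq R) : R -> Prop :=
  ideal_gen (fun r => r \in G).

Definition ideal0 (R : comNzRingType) : R -> Prop := fun r => r = 0.

Definition ideal_add (R : comNzRingType) (A B : R -> Prop) : R -> Prop :=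
  fun r => exists a b, [/\ A a, B b & r = a + b].

Definition ideal_mul (R : comNzRingType) (A B : R -> Prop) : R -> Prop :=
  ideal_gen (fun r => exists a b, [/\ A a, B b & r = a * b]).

(* The power of exponent 0 is the unit ideal. *)
Definition ideal_exp (R : comNzRingType) (A : R -> Prop) (m : nat) : R -> Prop :=
  iter m (ideal_mul A) (fun _ => True).

Definition prime_ideal (R : comNzRingType) (P : R -> Prop) : Prop :=
  [/\ is_ideal P, ~ P 1 & forall a b, P (a * b) -> P a \/ P b].

(* P is the annihilator of the class of some a in R/I. *)
Definition associated_prime (R : comNzRingType) (I P : R -> Prop) : Prop :=
  prime_ideal P /\ exists a, forall r, P r <-> I (r * a).

(* As R is a domain, its localization R_P at a prime P is the subring of
   Frac R of fractions whose denominator lies outside P. *)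
Definition localization (R : idomainType) (P : R -> Prop) :
    {fraction R} -> Prop :=
  fun u => exists a s, ~ P s /\ u = tofrac a / tofrac s.

(* J R_P, inside Frac R *)
Definition local_ext (R : idomainType) (P J : R -> Prop) :
    {fraction R} -> Prop :=
  fun u => exists t : seq ({fraction R} * R),
    (forall c, c \in t -> localization P c.1 /\ J c.2)
    /\ u = \sum_(c <- t) c.1 * tofrac c.2.

Definition symbolic_power (R : idomainType) (I : R -> Prop) (m : nat) :
    R -> Prop :=
  fun r => forall P, associated_prime I P ->
    local_ext P (ideal_exp I m) (tofrac r).

(* The members of G are pairwise distinct and generate J, and no proper subset
   of them generates J. *)
Definition minimal_generators (R : comNzRingType) (G : seq R) (J : R -> Prop) :
    Prop :=
  [/\ uniq G, ideal_eq (ideal_of_seq G) J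
    & forall S : R -> Prop, (forall r, S r -> r \in G) ->
        ideal_eq (ideal_gen S) J -> forall r, r \in G -> S r].

Definition pow_gens (R : comNzRingType) (a b : R) (s : nat) : seq R :=
  [seq a ^+ (s - j) * b ^+ j | j <- iota 0 s.+1].

(* Main.v *)
(* Let J_m be the intersection of (f,g)^m, (x,y)^m, (y,z)^m and (z,x)^m.  The primes of the
   n^2 + 3 points are all associated to I, and expanding along each of them gives
   I^(m) inside J_m.  Conversely I is the intersection of these primes, so every
   associated prime (I : t) lies in the prime of a point where t does not vanish;
   localizing there gives J_m inside I^(m).

   An element of J_kn in (fgh)^(k-i) (f,g)^(k(n-3)+3i) is, because f + g + h = 0,
   congruent modulo (fgh)^(k-i+1) (f,g)^(k(n-3)+3(i-1)) to a combination of
   (fgh)^(k-i) times f^a g^b, g^a h^b and h^a f^b, where a = (k-i)(n-3) + 2i and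
   b = i(n-2).  Modulo h only the first term survives, and since h has order n at
   (x,y) its coefficient lies in (x,y)^(in) + (h) = x^((i-1)n+1) (x,y)^(n-1) + (h);
   the same holds modulo f and g.  Descending from i = k to i = 0 exhausts J_kn.

   For minimality, a generator of the x-family at level i is compared in its own
   degree: modulo h^(k-i+1) only its siblings remain, and the substitutions
   y = zeta x with zeta^n = 1 show that they are independent. *)
Require Import Defs.
From HB Require Import structures.
From mathcomp Require Import all_boot all_order all_algebra.
From mathcomp Require Import mpoly.
From mathcomp Require Import cyclic.
From mathcomp Require Import ring zify.
From Stdlib Require Import Classical FunctionalExtensionality.

Set Implicit Arguments.
Unset Strict Implicit.
Unset Printing Implicit Defensive.

Import GRing.Theory.
Local Open Scope ring_scope.

(** The prime of each point is the kernel of a substitution, and orders along it are read off from a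
    ring morphism into [{poly R}]: as R is a domain, the order in ['X] is additive and denominators
    can be cancelled. The n^2 points must be treated together, since no single one of them sees (f,
    g). Their expansions are therefore normalised to have the same initial forms x and y up to a
    factor n z^(n-1); one comparison of coefficients then serves all points at once. The n distinct
    roots also ensure that this factor is nonzero: they force n to be invertible in K.

    The exponents in the descent balance: a + b = k(n-3) + 3i = kn - 3(k-i) is what remains of kn
    after k-i factors fgh are removed, while k-i+a = (k-i)(n-2)+2i and k-i+b = k+i(n-3) are the
    displayed exponents of f and g.

    Rotating x, y, z rotates f, g, h, so one coordinate point and one family are treated, with
    abstract variables. In the minimality argument, the degree n(kn+i) of a generator depends only
    on its level i; this is what makes comparison in one degree effective. *)

Section Ideals.
Variable R : comNzRingType.
Implicit Types (A B S : R -> Prop) (a b c r s u v w : R).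

Lemma idealN A r : is_ideal A -> A r -> A (- r).
Proof. by case=> _ _ AM Ar; rewrite -mulN1r; apply: AM. Qed.

Lemma idealB A r s : is_ideal A -> A r -> A s -> A (r - s).
Proof. by move=> Ai Ar As; case: (Ai) => _ AD _; apply: AD => //; apply: idealN. Qed.

Lemma ideal_sum A (J : eqType) (t : seq J) (F : J -> R) :
  is_ideal A -> (forall j, j \in t -> A (F j)) -> A (\sum_(j <- t) F j).
Proof.
case=> A0 AD _ AF; rewrite big_seq.
by apply: big_ind => // i it; apply: AF.
Qed.

Lemma ideal_gen_ideal S : is_ideal (ideal_gen S).
Proof.
split=> [|r s [t [St ->]] [t' [St' ->]]|c r [t [St ->]]].
- by exists [::]; rewrite big_nil; split.
- exists (t ++ t'); rewrite big_cat; split=> // d.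
  by rewrite mem_cat => /orP[/St|/St'].
- exists [seq (c * d.1, d.2) | d <- t]; split.
    by move=> e /mapP[d /St Sd ->].
  by rewrite big_map mulr_sumr; apply: eq_bigr => d _; rewrite mulrA.
Qed.

Lemma mem_ideal_gen S r : S r -> ideal_gen S r.
Proof.
move=> Sr; exists [:: (1, r)]; rewrite big_seq1 mul1r; split=> // c.
by rewrite inE => /eqP->.
Qed.

Lemma ideal_gen_sub S A :
  is_ideal A -> (forall r, S r -> A r) -> forall r, ideal_gen S r -> A r.
Proof.
move=> Ai SA r [t [St ->]]; apply: ideal_sum => // d dt.
by case: Ai => _ _ AM; apply/AM/SA/St.
Qed.

Lemma ideal_add_ideal A B :
  is_ideal A -> is_ideal B -> is_ideal (ideal_add A B).
Proof.
move=> [A0 AD AM] [B0 BD BM]; split.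
- by exists 0, 0; rewrite addr0.
- move=> _ _ [a [b [Aa Bb ->]]] [a' [b' [Aa' Bb' ->]]].
  by exists (a + a'), (b + b'); rewrite addrACA; split; auto.
- move=> c _ [a [b [Aa Bb ->]]].
  by exists (c * a), (c * b); rewrite mulrDr; split; auto.
Qed.

Lemma ideal0_ideal : is_ideal (@ideal0 R).
Proof.
by split=> // [r s -> ->|c r ->]; rewrite /ideal0 ?addr0 ?mulr0.
Qed.

Lemma ideal_exp_ideal A m : is_ideal (ideal_exp A m).
Proof. by case: m => [|m]; [split | apply: ideal_gen_ideal]. Qed.

Lemma mem_ideal_expS A m r s :
  A r -> ideal_exp A m s -> ideal_exp A m.+1 (r * s).
Proof. by move=> Ar As; apply: mem_ideal_gen; exists r, s. Qed.

Lemma ideal_seq2P a b r :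
  ideal_of_seq [:: a; b] r <-> exists u v, r = a * u + b * v.
Proof.
split=> [|[u [v ->]]]; last first.
  have [_ D M] := ideal_gen_ideal (fun r => r \in [:: a; b]).
  by apply: D; rewrite mulrC; apply/M/mem_ideal_gen; rewrite !inE eqxx ?orbT.
apply: (ideal_gen_sub (A := fun r => exists u v, r = a * u + b * v)) => [|s].
  split.
  - by exists 0, 0; rewrite !mulr0 addr0.
  - move=> _ _ [u [v ->]] [u' [v' ->]]; exists (u + u'), (v + v'); ring.
  - move=> c _ [u [v ->]]; exists (c * u), (c * v); ring.
rewrite !inE => /orP[]/eqP->; [exists 1, 0 | exists 0, 1]; ring.
Qed.

Lemma ideal_seq3P a b c r :
  ideal_of_seq [:: a; b; c] r <-> exists u v w, r = a * u + b * v + c * w.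
Proof.
split=> [|[u [v [w ->]]]]; last first.
  have [_ D M] := ideal_gen_ideal (fun r => r \in [:: a; b; c]).
  have E d e : d \in [:: a; b; c] -> ideal_of_seq [:: a; b; c] (d * e).
    by move=> dabc; rewrite mulrC; apply/M/mem_ideal_gen.
  by apply: (D _ _ (D _ _ (E a u _) (E b v _)) (E c w _));
     rewrite !inE eqxx ?orbT.
apply: (ideal_gen_sub (A := fun r => exists u v w, r = a * u + b * v + c * w))
  => [|s].
  split.
  - by exists 0, 0, 0; rewrite !mulr0 !addr0.
  - move=> _ _ [u [v [w ->]]] [u' [v' [w' ->]]].
    exists (u + u'), (v + v'), (w + w'); ring.
  - move=> d _ [u [v [w ->]]]; exists (d * u), (d * v), (d * w); ring.
rewrite !inE => /or3P[]/eqP->;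
  [exists 1, 0, 0 | exists 0, 1, 0 | exists 0, 0, 1]; ring.
Qed.

End Ideals.

Notation pair_exp a b m := (ideal_exp (ideal_of_seq [:: a; b]) m).

(** * Powers of an ideal with two generators *)

Section PairPowers.
Variable R : comNzRingType.
Implicit Types (A : R -> Prop) (a b c r s u v w : R).

Lemma pair_expS a b m r : pair_exp a b m.+1 r <->
  exists u v, [/\ pair_exp a b m u, pair_exp a b m v & r = a * u + b * v].
Proof.
have [Z D M] := ideal_exp_ideal (ideal_of_seq [:: a; b]) m.
split=> [|[u [v [Eu Ev ->]]]]; last first.
  have [_ D' _] := ideal_exp_ideal (ideal_of_seq [:: a; b]) m.+1.
  by apply: D'; apply: mem_ideal_expS => //; apply: mem_ideal_gen;
     rewrite !inE eqxx ?orbT.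
pose A r := exists u v, [/\ pair_exp a b m u, pair_exp a b m v & r = a * u + b * v].
apply: (ideal_gen_sub (A := A)) => [|_ [p [q [/ideal_seq2P[u [v ->]] Eq ->]]]].
  split.
  - by exists 0, 0; rewrite !mulr0 addr0.
  - move=> _ _ [u [v [? ? ->]]] [u' [v' [? ? ->]]].
    exists (u + u'), (v + v'); split; [exact: D|exact: D|ring].
  - move=> c _ [u [v [? ? ->]]].
    exists (c * u), (c * v); split; [exact: M|exact: M|ring].
exists (u * q), (v * q); split; [exact: M|exact: M|ring].
Qed.

Lemma pair_exp1 a b r :
  pair_exp a b 1 r <-> exists u v, r = a * u + b * v.
Proof.
split=> [/pair_expS[u [v [_ _ ->]]]|[u [v ->]]]; first by exists u, v.
by apply/pair_expS; exists u, v.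
Qed.

Lemma pair_expM a b m m' r s : pair_exp a b m r -> pair_exp a b m' s ->
  pair_exp a b (m + m') (r * s).
Proof.
elim: m r => [|m IH] r.
  by move=> _ Es; case: (ideal_exp_ideal (ideal_of_seq [:: a; b]) m') => _ _; apply.
move=> /pair_expS[u [v [Eu Ev ->]]] Es; rewrite addSn; apply/pair_expS.
by exists (u * s), (v * s); split; [exact: IH|exact: IH|ring].
Qed.

Lemma pair_expX a b m r e :
  pair_exp a b m r -> pair_exp a b (e * m) (r ^+ e).
Proof.
by move=> Er; elim: e => // e IH; rewrite exprS mulSn; apply: pair_expM.
Qed.

Lemma pair_exp_le a b m m' r :
  (m' <= m)%N -> pair_exp a b m r -> pair_exp a b m' r.
Proof.
elim: m m' r => [|m IH] [|m'] r // lem /pair_expS[u [v [Eu Ev ->]]].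
by apply/pair_expS; exists u, v; split=> //; apply: IH.
Qed.

Lemma pair_exp_mon a b m j : (j <= m)%N -> pair_exp a b m (a ^+ (m - j) * b ^+ j).
Proof.
move=> lejm; rewrite -[X in pair_exp _ _ X _](subnK lejm).
have Ea : pair_exp a b 1 a by apply/pair_exp1; exists 1, 0; ring.
have Eb : pair_exp a b 1 b by apply/pair_exp1; exists 0, 1; ring.
apply: pair_expM; first by rewrite -[X in pair_exp _ _ X _]muln1; apply: pair_expX.
by rewrite -[X in pair_exp _ _ X _]muln1; apply: pair_expX.
Qed.

Lemma pair_expP a b m r : pair_exp a b m r <->
  exists c : nat -> R, r = \sum_(j < m.+1) c j * (a ^+ (m - j) * b ^+ j).
Proof.
split=> [|[c ->]]; last first.
  apply: ideal_sum => [|j _]; first exact: ideal_exp_ideal.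
  have [_ _ M] := ideal_exp_ideal (ideal_of_seq [:: a; b]) m.
  by apply/M/pair_exp_mon; rewrite -ltnS.
elim: m r => [|m IH] r.
  by exists (fun=> r); rewrite big_ord1; ring.
move=> /pair_expS[u [v [/IH[c ->] /IH[d ->] ->]]].
(* Collecting [a * u + b * v] by powers of [b]: [c] keeps its index and is cut off after m, [d] is
   shifted by one. *)
exists (fun j => (if (j <= m)%N then c j else 0) + (if j is j'.+1 then d j' else 0)).
under [RHS]eq_bigr => j _ do rewrite mulrDl.
rewrite big_split /=; congr (_ + _).
  rewrite [RHS]big_ord_recr /= ltnn mul0r addr0 mulr_sumr; apply: eq_bigr => j _.
  by rewrite -ltnS ltn_ord subSn -1?ltnS // exprS; ring.
rewrite [RHS]big_ord_recl /= mul0r add0r mulr_sumr; apply: eq_bigr => j _.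
by rewrite /bump /= add1n subSS exprS; ring.
Qed.

Lemma pair_exp_ind a b m A : is_ideal A ->
  (forall j, (j <= m)%N -> A (a ^+ (m - j) * b ^+ j)) ->
  forall r, pair_exp a b m r -> A r.
Proof.
move=> Ai Aj r /pair_expP[c ->]; apply: ideal_sum => // j _.
by case: Ai => _ _ M; apply/M/Aj; rewrite -ltnS.
Qed.

Lemma pair_exp_sub a b a' b' m r :
  pair_exp a b 1 a' -> pair_exp a b 1 b' ->
  pair_exp a' b' m r -> pair_exp a b m r.
Proof.
move=> Ea Eb; elim: m r => // m IH r /pair_expS[u [v [Eu Ev ->]]].
have [_ D _] := ideal_exp_ideal (ideal_of_seq [:: a; b]) m.+1.
by apply: D; rewrite -[X in pair_exp _ _ X _]add1n; apply: pair_expM; auto.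
Qed.

End PairPowers.

(** * Orders of vanishing *)

Lemma mpoly_ring_ind n (K : comNzRingType) (P : {mpoly K[n]} -> Prop) :
  (forall c, P c%:MP) -> (forall i, P 'X_i) ->
  (forall p q, P p -> P q -> P (p + q)) ->
  (forall p q, P p -> P q -> P (p * q)) -> forall p, P p.
Proof.
move=> PC PX PD PM; elim/mpolyind => [|c m p _ _ IH]; first exact: (PC 0).
apply: (PD) => //; rewrite -mul_mpolyC; apply: (PM) => //.
rewrite mpolyXE_id; apply: (big_ind P) => [||i _]; first exact: (PC 1).
  exact: PM.
by elim: (m i) => [|e Pe]; [exact: (PC 1) | rewrite exprS; apply: PM].
Qed.

Lemma eq_mpoly_rmorphism n (K : comNzRingType) (S : nzRingType)
    (phi psi : {rmorphism {mpoly K[n]} -> S}) :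
  (forall c, phi c%:MP = psi c%:MP) -> (forall i, phi 'X_i = psi 'X_i) ->
  phi =1 psi.
Proof.
move=> eqC eqX; elim/mpoly_ring_ind => // p q Ep Eq.
  by rewrite !rmorphD Ep Eq.
by rewrite !rmorphM Ep Eq.
Qed.

(** The polynomials on which [phi] agrees with the identity modulo [A] form a subring, so the
    variables and constants decide. When [phi p = 0] this puts [p] in [A], which identifies kernels
    of substitutions. *)
Lemma rmorphism_congr n (K : comNzRingType) (A : {mpoly K[n]} -> Prop)
    (phi : {rmorphism {mpoly K[n]} -> {mpoly K[n]}}) :
  is_ideal A -> (forall c, phi c%:MP = c%:MP) ->
  (forall i, A ('X_i - phi 'X_i)) -> forall p, A (p - phi p).
Proof.
move=> Ai phiC AX; have [A0 AD AM] := Ai.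
elim/mpoly_ring_ind => [c|//|p q Ap Aq|p q Ap Aq]; first by rewrite phiC subrr.
  by rewrite rmorphD opprD addrACA; apply: AD.
have -> : p * q - phi (p * q) = q * (p - phi p) + phi p * (q - phi q).
  by rewrite rmorphM; ring.
by apply: AD; apply: AM.
Qed.

Lemma coef0_exp (R : nzRingType) (p : {poly R}) e : (p ^+ e)`_0 = p`_0 ^+ e.
Proof. by elim: e => [|e IH]; rewrite ?coef1 // !exprS coef0M IH. Qed.

Section OrderFamily.
Variable R : idomainType.

Definition ord_ge (m : nat) (p : {poly R}) := exists q, p = 'X^m * q.

Lemma ord_ge1 (p : {poly R}) : p`_0 = 0 -> ord_ge 1 p.
Proof.
move=> p0; exists (\poly_(i < (size p).-1) p`_i.+1); rewrite expr1.
apply/polyP => -[|i]; rewrite coefXM //= coef_poly; case: ltnP => // le_pi.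
by rewrite nth_default // -ltnS; case: (size p) le_pi => [|s] //=; rewrite ltnS.
Qed.

(** Over a domain a nonzero constant coefficient makes [s] regular modulo every power of ['X]. It
    serves to cancel denominators lying outside the prime of a point, and powers of h. *)
Lemma ord_ge_cancel m (s p : {poly R}) :
  s`_0 != 0 -> ord_ge m (s * p) -> ord_ge m p.
Proof.
move=> s0; elim: m p => [|m IH] p [q spq]; first by exists p; rewrite mul1r.
have /ord_ge1[p' def_p] : p`_0 = 0.
  apply/eqP; have /eqP : (s * p)`_0 = 0 by rewrite spq coefXnM.
  by rewrite coef0M mulf_eq0 (negPf s0).
rewrite expr1 in def_p.
have [|p'' def_p'] := IH p'.
  exists q; apply: (mulfI (monic_neq0 (monicX R))).
  by rewrite mulrCA -def_p spq exprS mulrA.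
by exists p''; rewrite def_p def_p' exprS mulrA.
Qed.

(* [phi s] is the expansion at a prime [P s] of height two, where [a1] and [a2]
   have the initial forms [kappa s * X] and [kappa s * Y]; the morphism [rho]
   shows that the monomials in [X] and [Y] are independent over the residues. *)
Lemma pair_exp_of_orders (T : Type) (D : T -> Prop)
    (phi : T -> {rmorphism R -> {poly R}}) (rho : {rmorphism R -> {poly R}})
    (a1 a2 X Y : R) (kappa : T -> R) (u v : T -> {poly R}) :
  (forall s, D s -> phi s a1 = 'X * u s) ->
  (forall s, D s -> phi s a2 = 'X * v s) ->
  (forall s, D s -> (u s)`_0 = kappa s * X) ->
  (forall s, D s -> (v s)`_0 = kappa s * Y) ->
  (forall s, D s -> kappa s != 0) ->
  rho X = 1 -> rho Y = 'X ->
  (forall s r, D s -> rho (phi s r)`_0 = ((phi s r)`_0)%:P) ->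
  (forall r, (forall s, D s -> (phi s r)`_0 = 0) ->
     exists b1 b2, r = a1 * b1 + a2 * b2) ->
  forall m r, (forall s, D s -> ord_ge m (phi s r)) -> pair_exp a1 a2 m r.
Proof.
move=> phi1 phi2 u0 v0 k0 rhoX rhoY rho_phi ker.
elim=> // m IH r ord_r.
have /pair_expP[c def_r] : pair_exp a1 a2 m r.
  apply: IH => s Ds; have [q ->] := ord_r s Ds.
  by exists ('X * q); rewrite exprSr mulrA.
have c0 j s : (j <= m)%N -> D s -> (phi s (c j))`_0 = 0.
  move=> lejm Ds; have [q phi_r] := ord_r s Ds.
  pose w := \sum_(i < m.+1) phi s (c i) * (u s ^+ (m - i) * v s ^+ i).
  have def_w : w = 'X * q.
    apply: (mulfI (monic_neq0 (monicXn _ m))).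
    rewrite mulrA -exprSr -phi_r def_r rmorph_sum mulr_sumr.
    apply: eq_bigr => i _; rewrite !rmorphM !rmorphXn /= phi1 // phi2 //.
    have -> : 'X^m = 'X^(m - i) * 'X^i :> {poly R}.
      by rewrite -exprD subnK // -ltnS.
    by rewrite !exprMn; ring.
  have w0 : w`_0 = kappa s ^+ m
      * \sum_(i < m.+1) (phi s (c i))`_0 * (X ^+ (m - i) * Y ^+ i).
    rewrite coef_sum mulr_sumr; apply: eq_bigr => i _.
    rewrite !coef0M !coef0_exp u0 // v0 // !exprMn.
    have -> : kappa s ^+ m = kappa s ^+ (m - i) * kappa s ^+ i.
      by rewrite -exprD subnK // -ltnS.
    by ring.
  have : w`_0 = 0 by rewrite def_w coefXM.
  rewrite w0 => /eqP; rewrite mulf_eq0 expf_eq0 (negPf (k0 s Ds)) andbF /=.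
  (* [rho] sends [X ^+ (m - i) * Y ^+ i] to ['X^i] and turns residues into constants, so the
     coefficient of ['X^j] isolates the residue of [c j]. *)
  move=> /eqP/(congr1 rho); rewrite rmorph0 rmorph_sum /=.
  rewrite (eq_bigr (fun i : 'I_m.+1 => ((phi s (c i))`_0)%:P * 'X^i)); last first.
    by move=> i _; rewrite !rmorphM !rmorphXn /= rhoX rhoY rho_phi // expr1n mul1r.
  move=> /polyP/(_ j); rewrite coef_sum coef0.
  have ltjm : (j < m.+1)%N by [].
  rewrite (bigD1 (Ordinal ltjm)) //=.
  rewrite coefCM coefXn eqxx mulr1 big1 ?addr0 // => i neq_ij.
  rewrite coefCM coefXn (_ : (j == i)%N = false) ?mulr0 //.
  by apply: contraNF neq_ij => /eqP e; apply/eqP/val_inj.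
(* Each [c i] vanishes at all points, hence lies in (a1, a2), and the exponent grows from m to m +
   1. *)
rewrite def_r; apply: ideal_sum => [|i _]; first exact: ideal_exp_ideal.
apply: (pair_expM (m := 1) (m' := m)); last by apply: pair_exp_mon; rewrite -ltnS.
by apply/pair_exp1/ker => s Ds; apply: c0 => //; rewrite -ltnS.
Qed.

End OrderFamily.

(** * The coordinate points *)

Section Substitutions.
Variables (K : fieldType) (a b c : 'I_3).
Hypothesis abc : uniq [:: a; b; c].

(** The variables are an arbitrary enumeration a, b, c of the three indices, so that statements
    about one coordinate point transfer to the other two by rotation. *)
Lemma vars3_cover i : i \in [:: a; b; c].
Proof.
have [j _||_ ->] := @uniq_min_size _ [:: a; b; c] (enum 'I_3) abc.
- by rewrite mem_enum.
- by rewrite size_enum_ord.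
- by rewrite mem_enum.
Qed.

Lemma vars3_ind (P : 'I_3 -> Prop) : P a -> P b -> P c -> forall i, P i.
Proof. by move=> Pa Pb Pc i; have := vars3_cover i; rewrite !inE => /or3P[]/eqP->. Qed.

Lemma neq_ba : (b == a) = false.
Proof. by move: abc; rewrite /= !inE eq_sym; case: eqP. Qed.

Lemma neq_ca : (c == a) = false.
Proof. by move: abc; rewrite /= !inE (eq_sym c); case: (a =P c); rewrite ?orbT. Qed.

Lemma neq_cb : (c == b) = false.
Proof. by move: abc; rewrite /= !inE (eq_sym c); case: (b =P c); rewrite ?andbF. Qed.

Definition subst3 (S : comNzRingType) (iota : {rmorphism K -> S}) (p q r : S) :
    {rmorphism {mpoly K[3]} -> S} :=
  mmap iota (fun i => if i == a then p else if i == b then q else r).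
Arguments subst3 : simpl never.

Section Values.
Variables (S : comNzRingType) (iota : {rmorphism K -> S}) (p q r : S).

Lemma subst3C d : subst3 iota p q r d%:MP = iota d.
Proof. exact: mmapC. Qed.

Lemma subst3a : subst3 iota p q r 'X_a = p.
Proof. by rewrite /subst3 /= mmapX mmap1U eqxx. Qed.

Lemma subst3b : subst3 iota p q r 'X_b = q.
Proof. by rewrite /subst3 /= mmapX mmap1U neq_ba eqxx. Qed.

Lemma subst3c : subst3 iota p q r 'X_c = r.
Proof. by rewrite /subst3 /= mmapX mmap1U neq_ca neq_cb. Qed.

Definition subst3E := (subst3C, subst3a, subst3b, subst3c).

Lemma eq_subst3 (phi : {rmorphism {mpoly K[3]} -> S}) :
  (forall d, phi d%:MP = iota d) -> phi 'X_a = p -> phi 'X_b = q ->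
  phi 'X_c = r -> phi =1 subst3 iota p q r.
Proof.
move=> phiC phia phib phic; apply: eq_mpoly_rmorphism => [d|].
  by rewrite subst3C.
by apply: vars3_ind; rewrite subst3E.
Qed.

End Values.

Local Notation R := {mpoly K[3]}.
Local Notation C0 := (@mpolyC 3 K).
Local Notation C1 := (polyC \o @mpolyC 3 K).
Local Notation x := ('X_a : R).
Local Notation y := ('X_b : R).
Local Notation z := ('X_c : R).

Definition coord_proj : {rmorphism R -> R} := subst3 C0 0 0 z.
(** Expansion along x = y = 0: the coefficient of ['X^d] collects the terms of degree d in x and y,
    with x and y kept as symbols. *)
Definition coord_germ : {rmorphism R -> {poly R}} :=
  subst3 C1 ('X * x%:P) ('X * y%:P) z%:P.

Lemma coord_germ0 r : (coord_germ r)`_0 = coord_proj r.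
Proof.
apply: (eq_subst3 (phi := coefp 0 \o coord_germ)) => [d|||] /=;
  by rewrite /coord_germ !subst3E /= ?coefC ?coefXM.
Qed.

Lemma coord_projP r : coord_proj r = 0 -> exists u v, r = x * u + y * v.
Proof.
move=> r0; apply/ideal_seq2P; rewrite -[r]subr0 -r0.
apply: rmorphism_congr => [|d|]; first exact: ideal_gen_ideal.
  by rewrite /coord_proj subst3E.
apply: vars3_ind; apply/ideal_seq2P; rewrite /coord_proj subst3E.
- by exists 1, 0; ring.
- by exists 0, 1; ring.
- by exists 0, 0; ring.
Qed.

(* The images of [x] and [y] are independent over [K[z]]. *)
Definition sep_xy : {rmorphism R -> {poly R}} := subst3 C1 1 'X z%:P.

Lemma coord_pair_exp m r : ord_ge m (coord_germ r) -> pair_exp x y m r.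
Proof.
move=> ord_r; have := @pair_exp_of_orders _ unit (fun=> True) (fun=> coord_germ)
  sep_xy x y x y (fun=> 1) (fun=> x%:P) (fun=> y%:P).
apply=> //.
- by rewrite /coord_germ subst3E.
- by rewrite /coord_germ subst3E.
- by rewrite coefC mul1r.
- by rewrite coefC mul1r.
- by rewrite oner_eq0.
- by rewrite /sep_xy subst3E.
- by rewrite /sep_xy subst3E.
- move=> _ s _; rewrite coord_germ0.
  apply: (@eq_mpoly_rmorphism _ _ _ (sep_xy \o coord_proj)
    (polyC \o coord_proj)) s => [d|]; first by rewrite /= /coord_proj !subst3E.
  by apply: vars3_ind; rewrite /= /coord_proj subst3E ?rmorph0 // subst3E.
- by move=> s /(_ tt I); rewrite coord_germ0; apply: coord_projP.
Qed.

End Substitutions.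

(** * The points with x^n = y^n = z^n *)

Lemma coef0_affine (R : nzRingType) (p q r : R) :
  (p%:P * (q%:P + 'X * r%:P))`_0 = p * q.
Proof. by rewrite coef0M coefD coefXM addr0 !coefC. Qed.

Lemma coef0_polyC (R : nzRingType) (r : R) : (r%:P)`_0 = r.
Proof. by rewrite coefC. Qed.

(** Both x^n and y^n are congruent to z^n, so the exponents of x and y may be reduced modulo n at
    the cost of powers of z. *)
Lemma monomial_residue (R : comNzRingType) (x y z k : R) n i j l :
  ideal_of_seq [:: x ^+ n - z ^+ n; y ^+ n - z ^+ n]
    (k * (x ^+ i * y ^+ j * z ^+ l) - x ^+ (i %% n) * y ^+ (j %% n)
       * (k * (z ^+ (i %/ n * n) * z ^+ (j %/ n * n) * z ^+ l))).
Proof.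
have divX (w : R) e : exists q, w ^+ (e * n) = (w ^+ n - z ^+ n) * q + z ^+ (e * n).
  by rewrite mulnC !exprM; exists (\sum_(t < e) (w ^+ n) ^+ (e.-1 - t) * (z ^+ n) ^+ t);
     rewrite -subrXX subrK.
rewrite {1}(divn_eq i n) {1}(divn_eq j n) !exprD.
have [p ->] := divX x (i %/ n)%N; have [q ->] := divX y (j %/ n)%N.
apply/ideal_seq2P; move: (x ^+ (i %% n)) (y ^+ (j %% n)) (z ^+ l) => x' y' z'.
move: (z ^+ (i %/ n * n)) (z ^+ (j %/ n * n)) => zi zj.
exists (p * k * x' * y' * z' * (zj + (y ^+ n - z ^+ n) * q)), (q * k * x' * y' * z' * zi).
ring.
Qed.

Lemma sum_delta2 (R : comNzRingType) (F d : nat -> nat -> R) e n i0 j0 :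
  (i0 < n)%N -> (j0 < n)%N ->
  \sum_(i < n) \sum_(j < n) F i j
    * (d i j + (if (i == i0 :> nat) && (j == j0 :> nat) then e else 0))
  = F i0 j0 * e + \sum_(i < n) \sum_(j < n) F i j * d i j.
Proof.
move=> lti ltj; rewrite addrC.
under eq_bigr => i _ do (under eq_bigr => j _ do rewrite mulrDr; rewrite big_split /=).
rewrite big_split /=; congr (_ + _).
rewrite (bigD1 (Ordinal lti)) //= [X in _ + X]big1 => [|i ne]; last first.
  rewrite big1 // => j _; case: eqP => [ei|_]; last by rewrite mulr0.
  by case/eqP: ne; apply: val_inj.
rewrite (bigD1 (Ordinal ltj)) //= !eqxx /= addr0 [X in _ + X]big1 ?addr0 // => j ne.
case: eqP => [ej|_]; last by rewrite mulr0.
by case/eqP: ne; apply: val_inj.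
Qed.

Section Points.
Variables (K : fieldType) (a b c : 'I_3).
Hypothesis abc : uniq [:: a; b; c].
Variables (n : nat) (rs : seq K).
Hypotheses (n_gt0 : (0 < n)%N) (rs_uniq : uniq rs) (size_rs : size rs = n).
Hypothesis rs_root : all n.-unity_root rs.

Local Notation R := {mpoly K[3]}.
Local Notation C0 := (@mpolyC 3 K).
Local Notation C1 := (polyC \o @mpolyC 3 K).
Local Notation x := ('X_a : R).
Local Notation y := ('X_b : R).
Local Notation z := ('X_c : R).

Lemma var_neq0 (i : 'I_3) : 'X_i != 0 :> R.
Proof.
apply/eqP => /(congr1 (mcoeff U_(i)%MM)).
by rewrite mcoeffX eqxx mcoeff0 => /eqP; rewrite oner_eq0.
Qed.

Lemma root_expn zeta : zeta \in rs -> zeta ^+ n = 1.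
Proof. by move=> /(allP rs_root)/unity_rootP. Qed.

Lemma root_neq0 zeta : zeta \in rs -> zeta != 0.
Proof.
move=> /root_expn z1; apply/eqP => z0.
by move/eqP: z1; rewrite z0 expr0n gtn_eqF // eq_sym oner_eq0.
Qed.

(** Among n distinct n-th roots of unity one is primitive, and a primitive n-th root exists only if
    the characteristic does not divide n. *)
Lemma natn_neq0 : n%:R != 0 :> K.
Proof.
have /hasP[zeta _ prim] : has n.-primitive_root rs.
  by apply: has_prim_root; rewrite ?size_rs.
exact: prim_root_natf_neq0 prim.
Qed.

(** The [v i] are the coefficients of a polynomial of degree less than n over R that vanishes at n
    distinct constants. This Vandermonde argument serves both for the ideal of the points and for
    minimality. *)
Lemma coef_extract (v : nat -> R) :
  (forall zeta, zeta \in rs -> \sum_(i < n) zeta%:MP ^+ i * v i = 0) ->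
  forall i, (i < n)%N -> v i = 0.
Proof.
move=> v_root; set p := \poly_(i < n) v i.
suff p0 : p = 0.
  by move=> i ltin; have := coef_poly n v i; rewrite -/p p0 coef0 ltin.
apply/eqP; apply: contraT => p_neq0.
have := @max_poly_roots _ p (map C0 rs) p_neq0.
rewrite size_map size_rs ltnNge size_poly /= => -> //; last first.
  by rewrite map_inj_uniq //; apply: (fmorph_inj C0).
apply/allP => _ /mapP[zeta zrs ->]; apply/rootP; rewrite horner_poly.
by rewrite -[RHS](v_root _ zrs); apply: eq_bigr => i _; rewrite mulrC.
Qed.

Definition point_proj (s : K * K) : {rmorphism R -> R} :=
  subst3 a b C0 (s.1%:MP * z) (s.2%:MP * z) z.

(** The roots multiply the increments as well as z, so [x ^+ n - z ^+ n] expands to (z + X x)^n -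
    z^n at every point and its initial form does not depend on [s]. *)
Definition point_germ (s : K * K) : {rmorphism R -> {poly R}} :=
  subst3 a b C1 ((s.1%:MP)%:P * (z%:P + 'X * x%:P))
    ((s.2%:MP)%:P * (z%:P + 'X * y%:P)) z%:P.

Lemma point_germ0 s r : (point_germ s r)`_0 = point_proj s r.
Proof.
apply: (eq_subst3 abc (phi := coefp 0 \o point_germ s)) => [d|||].
- by rewrite /= /point_germ subst3C coef0_polyC.
- by rewrite /= /point_germ subst3a coef0_affine.
- by rewrite /= /point_germ (subst3b abc) coef0_affine.
- by rewrite /= /point_germ (subst3c abc) coef0_polyC.
Qed.

Lemma mpoly3_monomial (m : 'X_{1..3}) k :
  k *: 'X_[m] = k%:MP * (x ^+ m a * y ^+ m b * z ^+ m c).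
Proof.
rewrite mul_mpolyC; congr (_ *: _); rewrite mpolyXE_id.
rewrite (bigD1 a) //= (bigD1 b) ?(neq_ba abc) //= (bigD1 c) ?(neq_ca abc) ?(neq_cb abc) //=.
rewrite big1 ?mulr1 ?mulrA // => i; move: i; apply: (vars3_ind abc);
  by rewrite ?eqxx ?andbF.
Qed.

(** Normal form modulo (x^n - z^n, y^n - z^n) in the monomials x^i y^j with i, j < n. The
    coefficients are polynomials in z; what matters of this is recorded as their being fixed by
    every [point_proj s]. *)
Lemma var_residue r : exists d : nat -> nat -> R,
  (forall i j s, point_proj s (d i j) = d i j) /\
  ideal_of_seq [:: x ^+ n - z ^+ n; y ^+ n - z ^+ n]
    (r - \sum_(i < n) \sum_(j < n) x ^+ i * y ^+ j * d i j).
Proof.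
have [_ AD AM] := ideal_gen_ideal (fun r => r \in [:: x ^+ n - z ^+ n; y ^+ n - z ^+ n]).
elim/mpolyind: r => [|k m p _ _ [d [dC dA]]].
  exists (fun _ _ => 0); split=> [i j s|]; first by rewrite rmorph0.
  rewrite big1 => [|i _]; last by rewrite big1 // => j _; rewrite mulr0.
  by rewrite subr0; apply/ideal_seq2P; exists 0, 0; rewrite !mulr0 addr0.
pose e := k%:MP * (z ^+ (m a %/ n * n) * z ^+ (m b %/ n * n) * z ^+ m c).
pose d' i j := d i j + (if ((i == m a %% n) && (j == m b %% n))%N then e else 0).
exists d'; split=> [i j s|].
  rewrite rmorphD dC; congr (_ + _); case: ifP => _; last exact: rmorph0.
  rewrite /point_proj /e !rmorphM !rmorphXn /= subst3C (subst3c abc) //.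
rewrite (sum_delta2 (fun i j => x ^+ i * y ^+ j)) ?ltn_pmod //.
rewrite opprD addrACA; apply: (AD) => //.
by rewrite mpoly3_monomial; apply: monomial_residue.
Qed.

Lemma root_mul_expn zeta (w : R) : zeta \in rs -> (zeta%:MP * w) ^+ n = w ^+ n.
Proof. by move=> zrs; rewrite exprMn -rmorphXn root_expn // rmorph1 mul1r. Qed.

Lemma point_proj_expn s : s.1 \in rs -> s.2 \in rs ->
  (point_proj s x) ^+ n = z ^+ n /\ (point_proj s y) ^+ n = z ^+ n.
Proof.
by move=> s1 s2; rewrite /point_proj subst3a (subst3b abc) !root_mul_expn.
Qed.

(** This says that (f, g) is the full ideal of the n^2 points: evaluating a normal form at all pairs
    of roots kills its coefficients, one variable at a time. *)
Lemma point_projP r :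
  (forall s, s.1 \in rs -> s.2 \in rs -> point_proj s r = 0) <->
  exists u v, r = (x ^+ n - z ^+ n) * u + (y ^+ n - z ^+ n) * v.
Proof.
have z0 e : z ^+ e != 0 by rewrite expf_neq0 ?var_neq0.
have projz s : point_proj s z = z by rewrite /point_proj (subst3c abc).
have ker s w : s.1 \in rs -> s.2 \in rs ->
    ideal_of_seq [:: x ^+ n - z ^+ n; y ^+ n - z ^+ n] w -> point_proj s w = 0.
  move=> s1 s2 /ideal_seq2P[u [v ->]]; have [Ex Ey] := point_proj_expn s1 s2.
  rewrite rmorphD !rmorphM !rmorphB !rmorphXn projz.
  by rewrite Ex Ey !subrr !mul0r addr0.
split=> [r0|/ideal_seq2P r_in s s1 s2]; last exact: ker.
apply/ideal_seq2P; have [d [dC dA]] := var_residue r.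
suff d0 i j : (i < n)%N -> (j < n)%N -> d i j = 0.
  move: dA; rewrite big1 ?subr0 // => i _; rewrite big1 // => j _.
  by rewrite d0 ?mulr0.
move=> ltin ltjn.
(* Fixing y = xi z and letting x = zeta z vary separates the powers of x; [step2] then does the same
   in y, and the powers of z cancel. *)
have step1 xi i' : xi \in rs -> (i' < n)%N ->
    z ^+ i' * \sum_(j' < n) (xi%:MP * z) ^+ j' * d i' j' = 0.
  move=> xrs; move: i'.
  apply: coef_extract => zeta zrs.
  have /eqP := ker (zeta, xi) _ zrs xrs dA.
  rewrite rmorphB (r0 (zeta, xi) zrs xrs) sub0r oppr_eq0 => /eqP E.
  rewrite -[RHS]E rmorph_sum; apply: eq_bigr => i' _.
  rewrite rmorph_sum !mulr_sumr; apply: eq_bigr => j' _.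
  rewrite !rmorphM !rmorphXn dC /point_proj /= subst3a (subst3b abc).
  by rewrite !exprMn !mulrA.
have step2 j' : (j' < n)%N -> z ^+ j' * d i j' = 0.
  move: j'; apply: coef_extract => xi xrs.
  apply: (mulfI (z0 i)); rewrite mulr0 -[RHS](step1 xi i xrs ltin).
  by congr (_ * _); apply: eq_bigr => j' _; rewrite exprMn mulrA.
by apply: (mulfI (z0 j)); rewrite mulr0 step2.
Qed.

(** The sum is the cofactor of X q in (p + X q)^n - p^n; at X = 0 it becomes the derivative of
    p^n. *)
Lemma sum_germ0 (S : comNzRingType) (p q : S) :
  (\sum_(i < n) (p%:P + 'X * q%:P) ^+ (n.-1 - i) * p%:P ^+ i)`_0
  = n%:R * p ^+ n.-1.
Proof.
rewrite coef_sum [RHS]mulr_natl (eq_bigr (fun=> p ^+ n.-1)) => [|i _].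
  by rewrite sumr_const card_ord.
rewrite coef0M !coef0_exp coefD coefXM addr0 !coef0_polyC -exprD subnK //.
by rewrite -ltnS prednK.
Qed.

Lemma point_pair_exp m r :
  (forall s, s.1 \in rs -> s.2 \in rs -> ord_ge m (point_germ s r)) ->
  pair_exp (x ^+ n - z ^+ n) (y ^+ n - z ^+ n) m r.
Proof.
move=> ord_r.
pose S (w : R) := \sum_(i < n) (z%:P + 'X * w%:P) ^+ (n.-1 - i) * z%:P ^+ i.
have germX (w : R) (zeta : K) : zeta \in rs ->
    ((zeta%:MP)%:P * (z%:P + 'X * w%:P)) ^+ n - z%:P ^+ n = 'X * (w%:P * S w).
  move=> zrs; rewrite exprMn -!rmorphXn root_expn // !rmorph1 mul1r rmorphXn.
  by rewrite subrXX addrC addKr mulrA.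
(* The initial forms are n z^(n-1) x and n z^(n-1) y; their common factor is [kappa], nonzero by
   [natn_neq0]. *)
have := @pair_exp_of_orders _ (K * K) (fun s => s.1 \in rs /\ s.2 \in rs)
  point_germ (sep_xy K a b c) (x ^+ n - z ^+ n) (y ^+ n - z ^+ n) x y
  (fun=> n%:R * z ^+ n.-1) (fun=> x%:P * S x) (fun=> y%:P * S y).
apply.
- move=> s [s1 s2]; rewrite rmorphB !rmorphXn /point_germ /= subst3a (subst3c abc).
  exact: germX.
- move=> s [s1 s2]; rewrite rmorphB !rmorphXn /point_germ /= (subst3b abc) (subst3c abc).
  exact: germX.
- by move=> s _; rewrite coef0M coef0_polyC sum_germ0 mulrC.
- by move=> s _; rewrite coef0M coef0_polyC sum_germ0 mulrC.
- move=> s _; rewrite mulf_neq0 ?expf_neq0 ?var_neq0 //.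
  by rewrite -(rmorph_nat C0) mpolyC_eq0 natn_neq0.
- by rewrite /sep_xy subst3a.
- by rewrite /sep_xy (subst3b abc).
- move=> s w _; rewrite point_germ0.
  apply: (@eq_mpoly_rmorphism _ _ _ (sep_xy K a b c \o point_proj s)
    (polyC \o point_proj s)) w => [d|].
    by rewrite /= /point_proj !subst3C.
  apply: (vars3_ind abc); rewrite /= /point_proj ?subst3a ?(subst3b abc) ?(subst3c abc).
  + by rewrite !rmorphM !subst3C !(subst3c abc).
  + by rewrite !rmorphM !subst3C !(subst3c abc).
  + by [].
- move=> w w0; apply/point_projP => s s1 s2; rewrite -point_germ0.
  exact: w0.
- by move=> s [s1 s2]; apply: ord_r.
Qed.

End Points.

(** * Symbolic powers and expansions *)

Lemma mulf_clear (F : fieldType) (s a j d : F) :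
  d != 0 -> s * a * j = d * s * (a / d * j).
Proof. by move=> d0; field. Qed.

Lemma ker_prime (R S : idomainType) (phi : {rmorphism R -> S}) :
  prime_ideal (fun r => phi r = 0).
Proof.
split.
- split=> [|r s r0 s0|u r r0]; rewrite ?rmorph0 ?rmorphD ?rmorphM //.
    by rewrite r0 s0 addr0.
  by rewrite r0 mulr0.
- by rewrite rmorph1 => /eqP; rewrite oner_eq0.
- move=> r s /eqP; rewrite rmorphM mulf_eq0 => /orP[]/eqP; by [left | right].
Qed.

(** Multiplication by [w] carries the kernel into [I]; conversely [r * w] in [I] gives
    [phi r * phi w = 0], and [phi w] cancels. Hence the kernel is (I : w). *)
Lemma associated_ker (R S : idomainType) (phi : {rmorphism R -> S})
    (I : R -> Prop) w :
  (forall r, I r -> phi r = 0) -> phi w != 0 ->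
  (forall r, phi r = 0 -> I (r * w)) ->
  associated_prime I (fun r => phi r = 0).
Proof.
move=> I0 w0 Iw; split; first exact: ker_prime.
exists w => r; split=> [/Iw//|/I0/eqP].
by rewrite rmorphM mulf_eq0 (negPf w0) orbF => /eqP.
Qed.

(** The product of the finitely many denominators clears the sum, and it stays outside [P] because
    [P] is prime. *)
Lemma local_ext_clear (R : idomainType) (P J : R -> Prop) r :
  prime_ideal P -> is_ideal J -> local_ext P J (tofrac r) ->
  exists2 s, ~ P s & J (s * r).
Proof.
move=> [[P0 _ _] P1 PM] [J0 JD JM] [t [tP def_r]].
suff [s Ps [w Jw E]] : exists2 s, ~ P s & exists2 w, J w &
    tofrac w = tofrac s * \sum_(c <- t) c.1 * tofrac c.2.
  by exists s => //; rewrite (_ : s * r = w) //; apply/eqP;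
     rewrite -tofrac_eq tofracM def_r E.
elim: t tP {def_r} => [|[u j] t IH] tP.
  by exists 1 => //; exists 0; rewrite // big_nil mulr0 rmorph0.
have [|s Ps [w Jw E]] := IH; first by move=> c ct; apply: tP; rewrite inE ct orbT.
have [|[a [d [Pd def_u]]] Jj] := tP (u, j); first by rewrite inE eqxx.
exists (d * s); first by move=> /PM[].
exists (s * a * j + d * w); first by apply: (JD); apply: (JM).
rewrite big_cons /= mulrDr tofracD !tofracM.
have d0 : tofrac d != 0 by rewrite tofrac_eq0; apply/eqP => d0; apply: Pd; rewrite d0.
rewrite E; congr (_ + _); last by rewrite mulrA.
move: def_u => /= ->; exact: mulf_clear.
Qed.

Lemma mem_local_ext (R : idomainType) (P J : R -> Prop) s r :
  is_ideal P -> ~ P s -> J (s * r) -> local_ext P J (tofrac r).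
Proof.
move=> [P0 _ _] Ps Jsr; exists [:: (tofrac 1 / tofrac s, s * r)]; split=> [c|].
  rewrite inE => /eqP->; split=> //; exists 1, s; split=> //.
have s0 : tofrac s != 0 by rewrite tofrac_eq0; apply/eqP => s0; apply: Ps; rewrite s0.
by rewrite big_seq1 /= tofracM tofrac1 div1r mulKf.
Qed.

Lemma ideal_exp_ord (R : idomainType) (phi : {rmorphism R -> {poly R}})
    (I : R -> Prop) m r :
  (forall r, I r -> (phi r)`_0 = 0) -> ideal_exp I m r -> ord_ge m (phi r).
Proof.
move=> I0; elim: m r => [|m IH] r; first by exists (phi r); rewrite mul1r.
apply: (ideal_gen_sub (A := fun r => ord_ge m.+1 (phi r))) => [|_ [a [b [Ia Eb ->]]]].
  split.
  - by exists 0; rewrite rmorph0 mulr0.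
  - by move=> u v [p Ep] [q Eq]; exists (p + q); rewrite rmorphD Ep Eq mulrDr.
  - by move=> u v [p Ep]; exists (phi u * p); rewrite rmorphM Ep mulrCA.
have [p Ep] := ord_ge1 (I0 a Ia); have [q Eq] := IH b Eb.
by exists (p * q); rewrite rmorphM Ep Eq expr1 exprS mulrACA.
Qed.

Lemma symbolic_ord (R : idomainType) (phi : {rmorphism R -> {poly R}})
    (I : R -> Prop) m r :
  associated_prime I (fun r => (phi r)`_0 = 0) ->
  (forall r, I r -> (phi r)`_0 = 0) ->
  symbolic_power I m r -> ord_ge m (phi r).
Proof.
move=> assP I0 /(_ _ assP) /local_ext_clear[||s /eqP s0 Es].
- by case: assP.
- exact: ideal_exp_ideal.
by apply: (ord_ge_cancel s0); rewrite -rmorphM; apply: ideal_exp_ord Es.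
Qed.

(** Source of denominators for localization: if [w] multiplies a and b into [I], then [w ^+ m]
    multiplies (a, b)^m into [I]^m. *)
Lemma pair_exp_scale (R : comNzRingType) (I : R -> Prop) a b w m r :
  I (w * a) -> I (w * b) -> pair_exp a b m r -> ideal_exp I m (w ^+ m * r).
Proof.
move=> Ia Ib; elim: m r => // m IH r /pair_expS[u [v [Eu Ev ->]]].
have [_ D _] := ideal_exp_ideal I m.+1.
have -> : w ^+ m.+1 * (a * u + b * v) =
    (w * a) * (w ^+ m * u) + (w * b) * (w ^+ m * v) by rewrite exprS; ring.
by apply: (D); apply: mem_ideal_expS => //; apply: IH.
Qed.

(** An equality of predicates rather than an [ideal_eq], so that the rotated ideal can be rewritten
    inside [symbolic_power]. *)
Lemma ideal_of_seq3_rot (R : comNzRingType) (p q r : R) :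
  ideal_of_seq [:: q; r; p] = ideal_of_seq [:: p; q; r].
Proof.
congr ideal_gen; apply: functional_extensionality => s.
by rewrite !inE orbA orbC.
Qed.

(** * Explicit memberships in I *)

Section FermatIdeal.
Variables (R : comNzRingType) (n : nat) (x y z : R).

Local Notation f := (y ^+ n - z ^+ n).
Local Notation g := (z ^+ n - x ^+ n).
Local Notation h := (x ^+ n - y ^+ n).

Definition fermat : R -> Prop := ideal_of_seq [:: x * f; y * g; z * h].

Lemma fermatP r :
  fermat r <-> exists u v w, r = x * f * u + y * g * v + z * h * w.
Proof. exact: ideal_seq3P. Qed.

Lemma rmorph_fgh_coord (S : comNzRingType) (phi : {rmorphism R -> S}) w :
  (0 < n)%N -> phi x = 0 -> phi y = 0 -> phi z = w ->
  [/\ phi f = - w ^+ n, phi g = w ^+ n & phi h = 0].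
Proof.
move=> n_gt0 Ex Ey Ez; rewrite !rmorphB !rmorphXn Ex Ey Ez expr0n gtn_eqF //.
by split; [exact: sub0r | exact: subr0 | exact: subrr].
Qed.

Lemma rmorph_fgh_point (S : comNzRingType) (phi : {rmorphism R -> S}) w :
  phi x ^+ n = w ^+ n -> phi y ^+ n = w ^+ n -> phi z = w ->
  [/\ phi f = 0, phi g = 0 & phi h = 0].
Proof. by move=> Ex Ey Ez; rewrite !rmorphB !rmorphXn Ex Ey Ez subrr. Qed.

Lemma fermat_coord0 (S : comNzRingType) (phi : {rmorphism R -> S}) r :
  phi x = 0 -> phi y = 0 -> phi h = 0 -> fermat r -> phi r = 0.
Proof.
move=> Ex Ey Eh /fermatP[u [v [w ->]]]; rewrite !rmorphD !rmorphM Ex Ey Eh.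
by rewrite mulr0 !mul0r !addr0.
Qed.

Lemma fermat_point0 (S : comNzRingType) (phi : {rmorphism R -> S}) r :
  phi f = 0 -> phi g = 0 -> phi h = 0 -> fermat r -> phi r = 0.
Proof.
move=> Ef Eg Eh /fermatP[u [v [w ->]]]; rewrite !rmorphD !rmorphM Ef Eg Eh.
by rewrite !mulr0 !mul0r !addr0.
Qed.

Lemma fermat_mul_fg : fermat (f * g * x) /\ fermat (f * g * y).
Proof.
by split; apply/fermatP; [exists g, 0, 0 | exists 0, f, 0]; ring.
Qed.

Lemma fermat_mul_xyz : fermat (x * y * z * f) /\ fermat (x * y * z * g).
Proof.
by split; apply/fermatP; [exists (y * z), 0, 0 | exists 0, (x * z), 0]; ring.
Qed.

(** Everything comes from f + g + h = 0: z u2 (f + g) = - z h u2, and g z x al = - x f z al - z h x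
    al. The shape is the one that vanishing at the three coordinate points imposes in
    [fermat_radical]. *)
Lemma fermat_glue u1 u2 v1 al be :
  fermat (f * (x * u1 + z * u2) + g * (y * v1 + z * (u2 + x * al + y * be))).
Proof.
apply/fermatP; exists (u1 - z * al), (v1 + z * be), (- u2 - x * al).
ring.
Qed.

Lemma fermat_coord u v : fermat ((x * u + y * v) * (f * g)).
Proof. by apply/fermatP; exists (u * g), (v * f), 0; ring. Qed.

(** For p = x - zeta z and q = y - xi z, the product p' q' vanishes at the other n^2 - 1 points and
    x y z at the coordinate points, so the multiplier carries the prime of the chosen point into
    I. *)
Lemma fermat_point u v p q p' q' :
  x ^+ n - z ^+ n = p * p' -> y ^+ n - z ^+ n = q * q' ->
  fermat ((p * u + q * v) * (x * y * z * p' * q')).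
Proof.
move=> Ep Eq; apply/fermatP.
exists (y * z * p' * v), (- (x * z * q' * u)), 0.
have -> : g = - (p * p') by rewrite -Ep opprB.
by rewrite Eq; ring.
Qed.

End FermatIdeal.

Lemma fermat_rot (R : comNzRingType) n (x y z : R) :
  fermat n y z x = fermat n x y z.
Proof. exact: ideal_of_seq3_rot. Qed.

(** * The associated primes of the Fermat ideal *)

Section FermatCoordinates.
Variables (K : fieldType) (a b c : 'I_3).
Hypothesis abc : uniq [:: a; b; c].
Variable n : nat.
Hypothesis n_gt0 : (0 < n)%N.

Local Notation R := {mpoly K[3]}.
Local Notation x := ('X_a : R).
Local Notation y := ('X_b : R).
Local Notation z := ('X_c : R).
Local Notation f := (y ^+ n - z ^+ n).
Local Notation g := (z ^+ n - x ^+ n).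
Local Notation h := (x ^+ n - y ^+ n).
Local Notation proj := (coord_proj K a b c).

Lemma coord_projE : [/\ proj x = 0, proj y = 0 & proj z = z].
Proof. by rewrite /coord_proj subst3a (subst3b abc) (subst3c abc). Qed.

Lemma coord_proj_fgh :
  [/\ proj f = - z ^+ n, proj g = z ^+ n & proj h = 0].
Proof. by have [Ex Ey Ez] := coord_projE; apply: rmorph_fgh_coord. Qed.

Lemma coord_proj_fermat r : fermat n x y z r -> proj r = 0.
Proof.
have [Ex Ey _] := coord_projE; have [_ _ Eh] := coord_proj_fgh.
by move=> Ir; exact: (fermat_coord0 Ex Ey Eh Ir).
Qed.

Lemma associated_coord : associated_prime (fermat n x y z) (fun r => proj r = 0).
Proof.
apply: (associated_ker (w := f * g)); first exact: coord_proj_fermat.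
  have [Ef Eg _] := coord_proj_fgh.
  by rewrite rmorphM Ef Eg mulNr oppr_eq0 mulf_neq0 ?expf_neq0 ?var_neq0.
by move=> r /(coord_projP abc)[u [v ->]]; apply: fermat_coord.
Qed.

Lemma symbolic_coord m r :
  symbolic_power (fermat n x y z) m r -> pair_exp x y m r.
Proof.
move=> sym_r; apply: (coord_pair_exp abc).
have E : (fun s => (coord_germ K a b c s)`_0 = 0) = (fun s => proj s = 0).
  by apply: functional_extensionality => s; rewrite (coord_germ0 abc).
have assP := associated_coord; rewrite -E in assP.
apply: (symbolic_ord assP _ sym_r) => s Is.
by rewrite (coord_germ0 abc); apply: coord_proj_fermat.
Qed.

(** Since [t] does not vanish at the point, [P] is contained in its prime. Outside that prime lies f
    g, which multiplies x and y into I, so (f g)^m is an admissible denominator. *)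
Lemma coord_local_ext P t m r : is_ideal P -> 
  (forall s, P s -> fermat n x y z (s * t)) -> proj t != 0 ->
  pair_exp x y m r -> local_ext P (ideal_exp (fermat n x y z) m) (tofrac r).
Proof.
move=> Pi Pt t0 xy_r; apply: (mem_local_ext (s := (f * g) ^+ m)) => //.
  move=> /Pt/coord_proj_fermat/eqP.
  have [Ef Eg _] := coord_proj_fgh.
  rewrite rmorphM rmorphXn rmorphM Ef Eg mulf_eq0 (negPf t0) orbF.
  by rewrite expf_eq0 mulNr oppr_eq0 -expr2 -exprM expf_eq0 (negPf (var_neq0 _ _)) !andbF.
have [Ix Iy] := fermat_mul_fg n x y z.
exact: (pair_exp_scale Ix Iy xy_r).
Qed.

End FermatCoordinates.

Section FermatSymbolic.
Variables (K : fieldType) (a b c : 'I_3).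
Hypothesis abc : uniq [:: a; b; c].
Variables (n : nat) (rs : seq K).
Hypotheses (n_gt0 : (0 < n)%N) (rs_uniq : uniq rs) (size_rs : size rs = n).
Hypothesis rs_root : all n.-unity_root rs.

Local Notation R := {mpoly K[3]}.
Local Notation x := ('X_a : R).
Local Notation y := ('X_b : R).
Local Notation z := ('X_c : R).
Local Notation f := (y ^+ n - z ^+ n).
Local Notation g := (z ^+ n - x ^+ n).
Local Notation h := (x ^+ n - y ^+ n).
Local Notation proj := (point_proj a b c).

Lemma uniq3_rot (i j l : 'I_3) : uniq [:: i; j; l] -> uniq [:: j; l; i].
Proof. by rewrite -(rot_uniq 1). Qed.

Lemma point_proj_fgh s : s.1 \in rs -> s.2 \in rs ->
  [/\ proj s f = 0, proj s g = 0 & proj s h = 0].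
Proof.
move=> s1 s2; have [Ex Ey] := point_proj_expn abc rs_root s1 s2.
have Ez : proj s z = z by rewrite /point_proj (subst3c abc).
exact: rmorph_fgh_point Ex Ey Ez.
Qed.

Lemma point_proj_fermat s r : s.1 \in rs -> s.2 \in rs ->
  fermat n x y z r -> proj s r = 0.
Proof.
move=> s1 s2; have [Ef Eg Eh] := point_proj_fgh s1 s2.
by move=> Ir; exact: (fermat_point0 Ef Eg Eh Ir).
Qed.

Lemma point_projK s r : proj s r = 0 ->
  exists u v, r = (x - s.1%:MP * z) * u + (y - s.2%:MP * z) * v.
Proof.
move=> r0; apply/ideal_seq2P; rewrite -[r]subr0 -r0.
apply: rmorphism_congr => [|d|]; first exact: ideal_gen_ideal.
  by rewrite /point_proj subst3C.
apply: (vars3_ind abc); apply/ideal_seq2P.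
- by exists 1, 0; rewrite /point_proj subst3a mulr1 mulr0 addr0.
- by exists 0, 1; rewrite /point_proj (subst3b abc) mulr1 mulr0 add0r.
- by exists 0, 0; rewrite /point_proj (subst3c abc) !mulr0 addr0 subrr.
Qed.

Lemma associated_point s : s.1 \in rs -> s.2 \in rs ->
  associated_prime (fermat n x y z) (fun r => proj s r = 0).
Proof.
move=> s1 s2.
(* [Q p q] is the quotient of p^n - q^n by p - q; at the point both arguments become zeta z and its
   value is n (zeta z)^(n-1), nonzero. *)
pose Q (p q : R) := \sum_(i < n) p ^+ (n.-1 - i) * q ^+ i.
apply: (associated_ker (w := x * y * z * Q x (s.1%:MP * z) * Q y (s.2%:MP * z))).
- by move=> r; apply: point_proj_fermat.
- have Ex : proj s x = s.1%:MP * z by rewrite /point_proj subst3a.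
  have Ey : proj s y = s.2%:MP * z by rewrite /point_proj (subst3b abc).
  have Ez : proj s z = z by rewrite /point_proj (subst3c abc).
  have C_neq0 (k : K) : k != 0 -> k%:MP * z != 0.
    by move=> k0; rewrite mulf_neq0 ?var_neq0 // mpolyC_eq0.
  have Q0 (p : R) (k : K) : k \in rs -> proj s p = k%:MP * z ->
      proj s (Q p (k%:MP * z)) != 0.
    move=> krs Ep; rewrite rmorph_sum (eq_bigr (fun=> (k%:MP * z) ^+ n.-1)) => [|i _].
      rewrite sumr_const card_ord -mulr_natl -(rmorph_nat (@mpolyC 3 K)).
      rewrite mulf_neq0 //; last first.
        by rewrite expf_neq0 // C_neq0 // (root_neq0 n_gt0 rs_root).
      by rewrite mpolyC_eq0 (natn_neq0 n_gt0 rs_uniq size_rs rs_root).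
    have Ek : proj s k%:MP = k%:MP by rewrite /point_proj subst3C.
    rewrite rmorphM !rmorphXn rmorphM Ep Ez Ek -exprD subnK //.
    by rewrite -ltnS prednK.
  rewrite !rmorphM Ex Ey Ez; apply: mulf_neq0; last exact: Q0.
  apply: mulf_neq0; last exact: Q0.
  by rewrite !mulf_neq0 ?C_neq0 ?var_neq0 // ?mpolyC_eq0 (root_neq0 n_gt0 rs_root).
- move=> r /point_projK[u [v ->]]; apply: fermat_point.
    by rewrite -subrXX (root_mul_expn rs_root).
  by rewrite -subrXX (root_mul_expn rs_root).
Qed.

Lemma symbolic_points m r :
  symbolic_power (fermat n x y z) m r -> pair_exp f g m r.
Proof.
move=> sym_r.
have Ef : pair_exp f g 1 f by apply/pair_exp1; exists 1, 0; rewrite mulr1 mulr0 addr0.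
have Eg : pair_exp f g 1 (x ^+ n - z ^+ n).
  by apply/pair_exp1; exists 0, (-1); rewrite mulr0 add0r mulrN1 opprB.
apply: (pair_exp_sub Eg Ef); apply: (point_pair_exp abc n_gt0 rs_uniq size_rs rs_root).
move=> s s1 s2.
have E : (fun w => (point_germ a b c s w)`_0 = 0) = (fun w => proj s w = 0).
  by apply: functional_extensionality => w; rewrite (point_germ0 abc).
have assP := associated_point s1 s2; rewrite -E in assP.
apply: (symbolic_ord assP _ sym_r) => w Iw.
by rewrite (point_germ0 abc); apply: point_proj_fermat.
Qed.

(** Vanishing at the n^2 points gives r = f u + g v. At y = z = 0 only g survives, so v is in (y,
    z); at z = x = 0 only f survives, so u is in (z, x); at x = y = 0 one has f = -g, so the z-parts
    of u and v agree modulo (x, y). Then [fermat_glue] applies. *)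
Lemma fermat_radical r :
  (forall s, s.1 \in rs -> s.2 \in rs -> proj s r = 0) ->
  coord_proj K a b c r = 0 -> coord_proj K b c a r = 0 ->
  coord_proj K c a b r = 0 -> fermat n x y z r.
Proof.
have bca := uniq3_rot abc; have cab := uniq3_rot bca.
move=> /(point_projP abc n_gt0 rs_uniq size_rs rs_root)[u [v Er]].
have {Er} : r = f * v + g * - u by rewrite Er mulrN -mulNr opprB addrC.
(* The names are exchanged: from here on [r = f * u + g * v]. *)
move: (- u) v => {}v {}u Er pc pa pb.
have pn (i : 'I_3) : 'X_i ^+ n != 0 :> R by rewrite expf_neq0 ?var_neq0.
have /(coord_projP bca)[v1 [v2 Ev]] : coord_proj K b c a v = 0.
  have [E1 E2 E3] := coord_proj_fgh K bca n_gt0.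
  move: pa; rewrite Er rmorphD !rmorphM E3 E1 mul0r add0r => /eqP.
  by rewrite mulf_eq0 oppr_eq0 (negPf (pn a)) => /eqP.
have /(coord_projP cab)[u2 [u1 Eu]] : coord_proj K c a b u = 0.
  have [E1 E2 E3] := coord_proj_fgh K cab n_gt0.
  move: pb; rewrite Er rmorphD !rmorphM E2 E3 mul0r addr0 => /eqP.
  by rewrite mulf_eq0 (negPf (pn b)) => /eqP.
have /(coord_projP abc)[al [be E]] : coord_proj K a b c (v2 - u2) = 0.
  have [E1 E2 E3] := coord_proj_fgh K abc n_gt0.
  have [Ex Ey Ez] := coord_projE K abc.
  move: pc; rewrite Er Ev Eu rmorphD !rmorphM E1 E2 !rmorphD !rmorphM Ex Ey Ez.
  rewrite !mul0r addr0 add0r mulNr addrC -!mulrBr => /eqP.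
  by rewrite !mulf_eq0 (negPf (pn c)) (negPf (var_neq0 _ _)) /= rmorphN => /eqP.
have := fermat_glue n x y z u1 u2 v1 al be.
rewrite Er Ev Eu (addrC (z * u2)) -addrA -E.
by rewrite (addrC u2) subrK.
Qed.

(* If [P = (I : t)] with [t] outside [I], then [t] does not vanish at some
   point of the configuration, and [P] is contained in the prime of that point:
   [I] has no embedded component. *)
Lemma mem_symbolic m r :
  pair_exp f g m r -> pair_exp x y m r -> pair_exp y z m r ->
  pair_exp z x m r -> symbolic_power (fermat n x y z) m r.
Proof.
move=> fg_r xy_r yz_r zx_r P [[Pi P1 _] [t Pt]].
have bca := uniq3_rot abc; have cab := uniq3_rot bca.
have Pt' s : P s -> fermat n x y z (s * t) by move/Pt.
apply: NNPP => notloc; apply: P1; apply/Pt; rewrite mul1r.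
apply: fermat_radical => [s s1 s2|||]; apply/eqP; apply/negPn/negP => t0; apply: notloc.
- apply: (mem_local_ext (s := (x * y * z) ^+ m)) => //.
    move=> /Pt'/(point_proj_fermat s1 s2)/eqP.
    have Ex : proj s x = s.1%:MP * z by rewrite /point_proj subst3a.
    have Ey : proj s y = s.2%:MP * z by rewrite /point_proj (subst3b abc).
    have Ez : proj s z = z by rewrite /point_proj (subst3c abc).
    rewrite rmorphM rmorphXn !rmorphM Ex Ey Ez mulf_eq0 (negPf t0) orbF.
    rewrite expf_eq0 !mulf_eq0 !mpolyC_eq0 !(negPf (var_neq0 _ _)).
    by rewrite !(negPf (root_neq0 n_gt0 rs_root _)) // andbF.
  have [If Ig] := fermat_mul_xyz n x y z.
  exact: (pair_exp_scale If Ig fg_r).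
- exact: (coord_local_ext abc n_gt0 Pi Pt' t0 xy_r).
- rewrite -(fermat_rot n x y z) in Pt' *.
  exact: (coord_local_ext bca n_gt0 Pi Pt' t0 yz_r).
- rewrite -(fermat_rot n x y z) -(fermat_rot n y z x) in Pt' *.
  exact: (coord_local_ext cab n_gt0 Pi Pt' t0 zx_r).
Qed.

End FermatSymbolic.

(** * Division modulo h *)

Section SpanPowers.
Variables (R : comNzRingType) (f g h : R).
Hypothesis fgh0 : h = - (f + g).
Variables (a b : nat).
Hypotheses (a_gt0 : (0 < a)%N) (b_gt0 : (0 < b)%N).

Local Notation T := (fun v => exists al be ga v',
  pair_exp f g (a + b - 3) v' /\
  v = al * (f ^+ a * g ^+ b) + be * (g ^+ a * h ^+ b) + ga * (h ^+ a * f ^+ b)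
      + f * g * h * v').

Lemma span_ideal : is_ideal T.
Proof.
have [Z D M] := ideal_exp_ideal (ideal_of_seq [:: f; g]) (a + b - 3).
split.
- by exists 0, 0, 0, 0; split=> //; ring.
- move=> _ _ [al [be [ga [v [Ev ->]]]]] [al' [be' [ga' [v' [Ev' ->]]]]].
  exists (al + al'), (be + be'), (ga + ga'), (v + v').
  by split; [exact: D | ring].
- move=> c _ [al [be [ga [v [Ev ->]]]]].
  exists (c * al), (c * be), (c * ga), (c * v).
  by split; [exact: M | ring].
Qed.

Let T_ideal := span_ideal.
Let TD := let: And3 _ D _ := T_ideal in D.
Let TM := let: And3 _ _ M := T_ideal in M.

Lemma mem_fgh v : pair_exp f g (a + b - 3) v -> T (f * g * h * v).
Proof. by move=> Ev; exists 0, 0, 0, v; split=> //; ring. Qed.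

(** Since f^(u+1) g^(w+1) (f + g) = - fgh f^u g^w, trading one f for one g only changes the sign
    modulo the last term of [T]. Walking both ways from f^a g^b reaches every monomial that contains
    both f and g. *)
Lemma span_mixed_swap u w : (u.+2 + w.+1 = a + b)%N ->
  T (f ^+ u.+2 * g ^+ w.+1) <-> T (f ^+ u.+1 * g ^+ w.+2).
Proof.
move=> Euw.
have Th : T (f * g * h * (f ^+ u * g ^+ w)).
  apply: mem_fgh; have -> : (a + b - 3 = u + w)%N by lia.
  by have := pair_exp_mon f g (leq_addl u w); rewrite addnK.
have E : f ^+ u.+2 * g ^+ w.+1 + f ^+ u.+1 * g ^+ w.+2 + f * g * h * (f ^+ u * g ^+ w) = 0.
  by rewrite fgh0 !exprS; ring.
split=> Tuw.
  have -> : f ^+ u.+1 * g ^+ w.+2 =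
    -1 * (f ^+ u.+2 * g ^+ w.+1 + f * g * h * (f ^+ u * g ^+ w)).
    by apply/eqP; rewrite mulN1r -addr_eq0 -E; apply/eqP; ring.
  exact: (TM _ (TD Tuw Th)).
have -> : f ^+ u.+2 * g ^+ w.+1 =
    -1 * (f ^+ u.+1 * g ^+ w.+2 + f * g * h * (f ^+ u * g ^+ w)).
  by apply/eqP; rewrite mulN1r -addr_eq0 -E; apply/eqP; ring.
exact: (TM _ (TD Tuw Th)).
Qed.

Lemma span_mixed u w : (u.+1 + w.+1 = a + b)%N -> T (f ^+ u.+1 * g ^+ w.+1).
Proof.
have T0 : T (f ^+ a * g ^+ b).
  exists 1, 0, 0, 0; split; last by ring.
  by case: (ideal_exp_ideal (ideal_of_seq [:: f; g]) (a + b - 3)).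
have up d : (d < b)%N -> T (f ^+ (a + d) * g ^+ (b - d)).
  elim: d => [|d IH] ltdb; first by rewrite addn0 subn0.
  have [u' Eu'] : exists u', (a + d = u'.+1)%N by exists (a + d).-1; lia.
  have [w' Ew'] : exists w', (b - d = w'.+2)%N by exists (b - d).-2; lia.
  have := IH (ltnW ltdb); rewrite Eu' Ew'.
  have [-> ->] : (a + d.+1 = u'.+2)%N /\ (b - d.+1 = w'.+1)%N by lia.
  by move/(span_mixed_swap (u := u') (w := w')); apply; lia.
have down d : (d < a)%N -> T (f ^+ (a - d) * g ^+ (b + d)).
  elim: d => [|d IH] ltda; first by rewrite addn0 subn0.
  have [u' Eu'] : exists u', (a - d = u'.+2)%N by exists (a - d).-2; lia.
  have [w' Ew'] : exists w', (b + d = w'.+1)%N by exists (b + d).-1; lia.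
  have := IH (ltnW ltda); rewrite Eu' Ew'.
  have [-> ->] : (a - d.+1 = u'.+1)%N /\ (b + d.+1 = w'.+2)%N by lia.
  by move/(span_mixed_swap (u := u') (w := w')); apply; lia.
move=> Euw; have [leau|ltua] := leqP a u.+1.
  have := up (u.+1 - a)%N.
  have [-> ->] : (a + (u.+1 - a) = u.+1)%N /\ (b - (u.+1 - a) = w.+1)%N by lia.
  by apply; lia.
have := down (a - u.+1)%N.
have [-> ->] : (a - (a - u.+1) = u.+1)%N /\ (b + (a - u.+1) = w.+1)%N by lia.
by apply; lia.
Qed.

Lemma span_mul_fg r : pair_exp f g (a + b - 2) r -> T (f * g * r).
Proof.
apply: (pair_exp_ind (A := fun r => T (f * g * r))) => [|j lej].
  have [T0 _ _] := T_ideal; split=> [|r1 r2 T1 T2|c r1 T1].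
  - by rewrite mulr0.
  - by rewrite mulrDr; apply: TD.
  - by rewrite mulrCA; apply: TM.
have -> : f * g * (f ^+ (a + b - 2 - j) * g ^+ j) = f ^+ (a + b - 2 - j).+1 * g ^+ j.+1.
  by rewrite !exprS; ring.
by apply: span_mixed; lia.
Qed.

Let Eh : pair_exp f g 1 h.
Proof. by apply/pair_exp1; exists (-1), (-1); rewrite fgh0; ring. Qed.

Let Ef : pair_exp f g 1 f.
Proof. by apply/pair_exp1; exists 1, 0; ring. Qed.

Let Eg : pair_exp f g 1 g.
Proof. by apply/pair_exp1; exists 0, 1; ring. Qed.

Lemma pair_exp_monM p q u w : pair_exp f g 1 p -> pair_exp f g 1 q ->
  pair_exp f g (u + w) (p ^+ u * q ^+ w).
Proof.
move=> Ep Eq; have := pair_expM (pair_expX u Ep) (pair_expX w Eq).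
by rewrite !muln1.
Qed.

(** Start from f^b h^a, which is in [T], and replace one h at a time by -(f + g): the f-part raises
    the power of f, and the g-part is divisible by f g, so [span_mul_fg] absorbs it. The power of g
    is reached in the same way from g^a h^b. *)
Lemma span_pure_f : T (f ^+ (a + b)).
Proof.
have [T0 _ _] := T_ideal.
have H d : (d <= a)%N -> T (f ^+ (b + d) * h ^+ (a - d)).
  elim: d => [|d IH] led.
    exists 0, 0, 1, 0; rewrite addn0 subn0; split; last by ring.
    by case: (ideal_exp_ideal (ideal_of_seq [:: f; g]) (a + b - 3)).
  have [u' Eu'] : exists u', (b + d = u'.+1)%N by exists (b + d).-1; lia.
  have [w' Ew'] : exists w', (a - d = w'.+1)%N by exists (a - d).-1; lia.
  have := IH (ltnW led); rewrite Eu' Ew'.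
  have [-> ->] : (b + d.+1 = u'.+2)%N /\ (a - d.+1 = w')%N by lia.
  move=> Tuw.
  have Tg : T (f * g * (f ^+ u' * h ^+ w')).
    apply: span_mul_fg; have -> : (a + b - 2 = u' + w')%N by lia.
    exact: pair_exp_monM.
  have -> : f ^+ u'.+2 * h ^+ w' =
      -1 * (f ^+ u'.+1 * h ^+ w'.+1 + f * g * (f ^+ u' * h ^+ w')).
    have -> : h ^+ w'.+1 = - (f + g) * h ^+ w' by rewrite exprS fgh0.
    by rewrite !exprS; ring.
  exact: (TM _ (TD Tuw Tg)).
by have := H a (leqnn a); rewrite subnn mulr1 addnC.
Qed.

Lemma span_pure_g : T (g ^+ (a + b)).
Proof.
have H d : (d <= b)%N -> T (g ^+ (a + d) * h ^+ (b - d)).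
  elim: d => [|d IH] led.
    exists 0, 1, 0, 0; rewrite addn0 subn0; split; last by ring.
    by case: (ideal_exp_ideal (ideal_of_seq [:: f; g]) (a + b - 3)).
  have [u' Eu'] : exists u', (a + d = u'.+1)%N by exists (a + d).-1; lia.
  have [w' Ew'] : exists w', (b - d = w'.+1)%N by exists (b - d).-1; lia.
  have := IH (ltnW led); rewrite Eu' Ew'.
  have [-> ->] : (a + d.+1 = u'.+2)%N /\ (b - d.+1 = w')%N by lia.
  move=> Tuw.
  have Tg : T (f * g * (g ^+ u' * h ^+ w')).
    apply: span_mul_fg; have -> : (a + b - 2 = u' + w')%N by lia.
    exact: pair_exp_monM.
  have -> : g ^+ u'.+2 * h ^+ w' =
      -1 * (g ^+ u'.+1 * h ^+ w'.+1 + f * g * (g ^+ u' * h ^+ w')).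
    have -> : h ^+ w'.+1 = - (f + g) * h ^+ w' by rewrite exprS fgh0.
    by rewrite !exprS; ring.
  exact: (TM _ (TD Tuw Tg)).
by have := H b (leqnn b); rewrite subnn mulr1.
Qed.

Lemma pair_exp_span v : pair_exp f g (a + b) v -> T v.
Proof.
apply: pair_exp_ind => [|j lej]; first exact: T_ideal.
case: j lej => [|j] lej; first by rewrite subn0 mulr1; apply: span_pure_f.
have [u Eu] : exists u, (a + b - j.+1 = u)%N by eexists.
rewrite Eu; case: u Eu => [|u] Eu.
  by rewrite mul1r (_ : j.+1 = a + b)%N; [apply: span_pure_g | lia].
by apply: span_mixed; lia.
Qed.

End SpanPowers.

Section ModuloH.
Variables (R : comNzRingType) (n : nat) (x y z : R).
Hypothesis n_gt0 : (0 < n)%N.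

Local Notation f := (y ^+ n - z ^+ n).
Local Notation g := (z ^+ n - x ^+ n).
Local Notation h := (x ^+ n - y ^+ n).

Definition pair_mod m w := exists u s, pair_exp x y m u /\ w = u + h * s.

Lemma pair_mod_ideal m : is_ideal (pair_mod m).
Proof.
have [Z D M] := ideal_exp_ideal (ideal_of_seq [:: x; y]) m.
split.
- by exists 0, 0; split=> //; ring.
- move=> _ _ [u [s [Eu ->]]] [u' [s' [Eu' ->]]].
  by exists (u + u'), (s + s'); split; [exact: D | ring].
- move=> c _ [u [s [Eu ->]]].
  by exists (c * u), (c * s); split; [exact: M | ring].
Qed.

Hypothesis z_regular : forall m w, pair_mod m (z * w) -> pair_mod m w.

Lemma pair_mod_zX m e w : pair_mod m (z ^+ e * w) -> pair_mod m w.
Proof.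
by elim: e w => [|e IH] w; rewrite ?mul1r // exprSr -mulrA => /IH/z_regular.
Qed.

(* Both [f = y^n - z^n] and [g = z^n - x^n] divide [z^(n i)] modulo
   [(x, y)^(i n)], and [z] is regular. *)
Lemma pair_mod_regular i p w : p = f \/ p = g ->
  pair_mod (i * n) (p * w) -> pair_mod (i * n) w.
Proof.
move=> def_p pw; apply: (@pair_mod_zX _ (n * i)).
have [_ D M] := pair_mod_ideal (i * n).
have mon v t : v = x \/ v = y -> pair_mod (i * n) (v ^+ (n * i) * t).
  move=> def_v; exists (v ^+ (n * i) * t), 0; split; last by rewrite mulr0 addr0.
  rewrite mulrC; case: (ideal_exp_ideal (ideal_of_seq [:: x; y]) (i * n)) => _ _; apply.
  have Ev : pair_exp x y 1 v.
    by apply/pair_exp1; case: def_v => ->; [exists 1, 0 | exists 0, 1]; ring.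
  by have := pair_expX (n * i) Ev; rewrite muln1 mulnC.
case: def_p pw => -> pw.
  have /(congr1 (fun t => t * w)) := subrXX (y ^+ n) (z ^+ n) i.
  rewrite -!exprM mulrBl -mulrA (mulrCA f) => E.
  have -> : z ^+ (n * i) * w = y ^+ (n * i) * w
      + (-1) * (y ^+ (n * i) * w - z ^+ (n * i) * w) by ring.
  rewrite E; apply: (D); first by apply: mon; right.
  by apply: (M); apply: (M).
have /(congr1 (fun t => t * w)) := subrXX (z ^+ n) (x ^+ n) i.
rewrite -!exprM mulrBl -mulrA (mulrCA g) => E.
have -> : z ^+ (n * i) * w = x ^+ (n * i) * w
    + (z ^+ (n * i) * w - x ^+ (n * i) * w) by ring.
rewrite E; apply: (D); first by apply: mon; left.
exact: (M).
Qed.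

Lemma pair_mod_regularX i p q w :
  pair_mod (i * n) (f ^+ p * g ^+ q * w) -> pair_mod (i * n) w.
Proof.
elim: p => [|p IH].
  rewrite mul1r; elim: q => [|q IH]; first by rewrite mul1r.
  by rewrite exprS -mulrA => /(pair_mod_regular (or_intror erefl)).
by rewrite exprS -!mulrA => /(pair_mod_regular (or_introl erefl)); rewrite mulrA.
Qed.

(** Modulo h, y^n may be traded for x^n, which brings x^(in-j) y^j to j < n. Then x^(in-j) =
    x^((i-1)n+1) x^(n-1-j), and the exponent n-1-j is nonnegative. *)
Lemma pair_exp_reduce i r : (0 < i)%N -> pair_exp x y (i * n) r ->
  exists u s, pair_exp x y (n - 1) u /\ r = x ^+ ((i - 1) * n + 1) * u + h * s.
Proof.
move=> i_gt0; pose A r := exists u s,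
  pair_exp x y (n - 1) u /\ r = x ^+ ((i - 1) * n + 1) * u + h * s.
have Ai : is_ideal A.
  have [Z D M] := ideal_exp_ideal (ideal_of_seq [:: x; y]) (n - 1).
  split.
  - by exists 0, 0; split=> //; ring.
  - move=> _ _ [u [s [Eu ->]]] [u' [s' [Eu' ->]]].
    by exists (u + u'), (s + s'); split; [exact: D | ring].
  - move=> c _ [u [s [Eu ->]]].
    by exists (c * u), (c * s); split; [exact: M | ring].
apply: (pair_exp_ind (A := A)) => // j; have [N leN] := ubnP j.
elim: N j leN => // N IH j leN lej; have [ltjn|lenj] := ltnP j n.
  exists (x ^+ (n - 1 - j) * y ^+ j), 0; split; first by apply: pair_exp_mon; lia.
  rewrite mulr0 addr0 mulrA -exprD; congr (x ^+ _ * _).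
  by case: i i_gt0 {A Ai IH} lej => // i _ _; rewrite mulSn subSS subn0; lia.
have [u [s [Eu E]]] : A (x ^+ (i * n - (j - n)) * y ^+ (j - n)) by apply: IH; lia.
exists u, (s - x ^+ (i * n - j) * y ^+ (j - n)); split=> //.
have E1 : x ^+ (i * n - (j - n)) = x ^+ (i * n - j) * x ^+ n.
  by rewrite -exprD; congr (x ^+ _); lia.
have -> : y ^+ j = y ^+ (j - n) * y ^+ n by rewrite -exprD subnK.
by rewrite mulrBr addrA -E E1; ring.
Qed.

Hypothesis h_cancel : forall e m w,
  pair_exp x y (e * n + m) (h ^+ e * w) -> pair_exp x y m w.

(** The factor h^c accounts for cn of the order (c+i)n; the remaining in falls on f^p g^q al modulo
    h, where f and g can be cancelled. *)
Lemma coef_reduce i c p q al w : (0 < i)%N ->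
  pair_exp x y ((c + i) * n) (h ^+ c * (f ^+ p * g ^+ q * al + h * w)) ->
  exists u s, pair_exp x y (n - 1) u /\ al = x ^+ ((i - 1) * n + 1) * u + h * s.
Proof.
move=> i_gt0; rewrite mulnDl => /h_cancel Ein.
have /pair_mod_regularX[u [s [Eu ->]]] : pair_mod (i * n) (f ^+ p * g ^+ q * al).
  by exists (f ^+ p * g ^+ q * al + h * w), (- w); split=> //; ring.
have [u' [s' [Eu' ->]]] := pair_exp_reduce i_gt0 Eu.
by exists u', (s' + s); split=> //; ring.
Qed.

End ModuloH.

(** * Generation *)

Section Regularity.
Variables (R : idomainType) (n : nat) (x y z : R).
Local Notation h := (x ^+ n - y ^+ n).

(** As h is homogeneous of degree n in x and y, its expansion is exactly X^n h; dividing by X^(en)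
    leaves the nonzero constant h^e, which [ord_ge_cancel] removes. *)
Lemma pair_exp_cancel (phi : {rmorphism R -> {poly R}}) :
  phi x = 'X * x%:P -> phi y = 'X * y%:P ->
  (forall m r, ord_ge m (phi r) -> pair_exp x y m r) -> h != 0 ->
  forall e m w, pair_exp x y (e * n + m) (h ^+ e * w) -> pair_exp x y m w.
Proof.
move=> Ex Ey ord_pair h0 e m w Ehw; apply: ord_pair.
have [|q Eq] := @ideal_exp_ord _ phi (ideal_of_seq [:: x; y]) _ _ _ Ehw.
  move=> r /ideal_seq2P[u [v ->]].
  by rewrite rmorphD !rmorphM Ex Ey -!mulrA coefD !coefXM addr0.
have Eh : phi h = 'X^n * h%:P.
  by rewrite rmorphB !rmorphXn Ex Ey !exprMn -mulrBr rmorphB !rmorphXn.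
apply: (@ord_ge_cancel _ m ((h ^+ e)%:P)); first by rewrite coefC expf_neq0.
exists q; apply: (mulfI (monic_neq0 (monicXn R (e * n)))).
rewrite [RHS]mulrA -exprD -Eq rmorphM rmorphXn Eh exprMn -exprM mulnC.
by rewrite rmorphXn mulrA.
Qed.

(** Here [sigma] is the substitution z = 0. Subtracting from z w = u + h s its image under [sigma]
    makes both summands divisible by z, and the quotient of u - sigma u stays in (x, y)^m because x
    and y are fixed. *)
Lemma pair_mod_z (sigma : {rmorphism R -> R}) :
  sigma x = x -> sigma y = y -> sigma z = 0 ->
  (forall r, exists r', r - sigma r = z * r') -> z != 0 ->
  forall m w, pair_mod n x y m (z * w) -> pair_mod n x y m w.
Proof.
move=> Ex Ey Ez sigma_z z0 m w [u [s [Eu E]]].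
have [u' Eu' def_u'] : exists2 u', pair_exp x y m u' & u - sigma u = z * u'.
  elim: m u Eu {E} => [|m IH] u; first by have [u' ->] := sigma_z u; exists u'.
  move=> /pair_expS[p [q [/IH[p' Ep' Ep] /IH[q' Eq' Eq] ->]]].
  exists (x * p' + y * q'); first by apply/pair_expS; exists p', q'.
  rewrite rmorphD !rmorphM Ex Ey.
  rewrite mulrDr (mulrCA z x) (mulrCA z y) -Ep -Eq; ring.
have [s' Es'] := sigma_z s.
exists u', s'; split=> //; apply: (mulfI z0).
rewrite mulrDr -def_u' (mulrCA z) -Es'.
have := congr1 sigma E; rewrite rmorphM Ez mul0r rmorphD rmorphM rmorphB !rmorphXn Ex Ey.
by rewrite E => E0; rewrite -[LHS]subr0 E0; ring.
Qed.

End Regularity.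

(** * The descent on powers of fgh *)

Section Descent.
Variables (R : comNzRingType) (n k : nat) (x y z : R).
Hypothesis n_ge3 : (3 <= n)%N.

Local Notation f := (y ^+ n - z ^+ n).
Local Notation g := (z ^+ n - x ^+ n).
Local Notation h := (x ^+ n - y ^+ n).

Definition coord_coef i :=
  f ^+ ((k - i) * (n - 2) + 2 * i) * g ^+ (k + i * (n - 3)) * h ^+ (k - i)
  * x ^+ ((i - 1) * n + 1).

(** The conclusion of [coef_reduce], isolated so that the descent can assume it for the three
    rotations over any commutative ring. *)
Definition reducible :=
  forall i c p q al w, (0 < i)%N ->
  pair_exp x y ((c + i) * n) (h ^+ c * (f ^+ p * g ^+ q * al + h * w)) ->
  exists u s, pair_exp x y (n - 1) u /\ al = x ^+ ((i - 1) * n + 1) * u + h * s.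

End Descent.

Section Generation.
Variables (R : comNzRingType) (n k : nat) (x y z : R).
Hypothesis n_ge3 : (3 <= n)%N.

Local Notation f := (y ^+ n - z ^+ n).
Local Notation g := (z ^+ n - x ^+ n).
Local Notation h := (x ^+ n - y ^+ n).

Hypotheses (red_x : reducible n x y z) (red_y : reducible n y z x)
  (red_z : reducible n z x y).

Variable M : R -> Prop.
Hypothesis M_ideal : is_ideal M.
Hypothesis M0 : forall u, pair_exp f g ((n - 3) * k) u -> M ((f * g * h) ^+ k * u).
Hypothesis Mx : forall i u, (0 < i <= k)%N -> pair_exp x y (n - 1) u ->
  M (coord_coef n k x y z i * u).
Hypothesis My : forall i u, (0 < i <= k)%N -> pair_exp y z (n - 1) u ->
  M (coord_coef n k y z x i * u).
Hypothesis Mz : forall i u, (0 < i <= k)%N -> pair_exp z x (n - 1) u ->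
  M (coord_coef n k z x y i * u).
Hypothesis M_sub : forall r, M r -> [/\ pair_exp x y (k * n) r,
  pair_exp y z (k * n) r & pair_exp z x (k * n) r].

(* Modulo [h] only the term in [f^a.+1 g^b.+1] survives, and the order of [r] at
   [(x, y)] forces its coefficient into [x^(i n + 1) (x, y)^(n-1) + (h)]. *)
Lemma descent_step i v r : (i < k)%N ->
  pair_exp f g (k * (n - 3) + 3 * i.+1) v ->
  r = (f * g * h) ^+ (k - i.+1) * v ->
  [/\ pair_exp x y (k * n) r, pair_exp y z (k * n) r & pair_exp z x (k * n) r] ->
  exists m v', [/\ M m, pair_exp f g (k * (n - 3) + 3 * i) v' &
    r - m = (f * g * h) ^+ (k - i) * v'].
Proof.
move=> ltik Ev def_r [rxy ryz rzx].
set c := (k - i.+1)%N in def_r *.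
(* These are the exponents of the overview minus one: each of the three monomials has to release one
   factor of each of its two bases. *)
pose a := (c * (n - 3) + 2 * i.+1).-1%N; pose b := (i.+1 * (n - 2)).-1%N.
have Ea : a.+1 = (c * (n - 3) + 2 * i.+1)%N by rewrite /a prednK // addn_gt0 orbC muln_gt0.
have Eb : b.+1 = (i.+1 * (n - 2))%N.
  by rewrite /b prednK // muln_gt0 subn_gt0.
have Ek : (k = c + i.+1)%N by rewrite /c; lia.
have Eab : (a.+1 + b.+1 = k * (n - 3) + 3 * i.+1)%N.
  by rewrite Ea Eb Ek; case: n n_ge3 => [|[|[|m]]] // _; rewrite !subSS !subn0; nia.
have fgh0 : h = - (f + g) by ring.
have {}Ev : pair_exp f g (a.+1 + b.+1) v by rewrite Eab.
have [al [be [ga [v' [Ev' def_v]]]]] := pair_exp_span fgh0 (ltn0Sn a) (ltn0Sn b) Ev.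
have {Ea} Ea : ((k - i.+1) * (n - 2) + 2 * i.+1 = c + a.+1)%N.
  by rewrite Ea -/c; case: n n_ge3 => [|[|[|m]]] // _; rewrite !subSS !subn0; nia.
have {Eb} Eb : (k + i.+1 * (n - 3) = c + b.+1)%N.
  by rewrite Eb Ek; case: n n_ge3 => [|[|[|m]]] // _; rewrite !subSS !subn0; nia.
(* The other two monomials and the remainder each contain h. One factor h is taken out, and the
   rest, times f^c g^c, is the [w] of [reducible]. *)
have [|u1 [s1 [Eu1 def_al]]] := @red_x i.+1 c (c + a.+1) (c + b.+1) al
   (f ^+ c * g ^+ c * (be * g ^+ a.+1 * h ^+ b + ga * h ^+ a * f ^+ b.+1 + f * g * v'))
   (ltn0Sn _).
  rewrite -Ek (_ : h ^+ c * _ = r) // def_r def_v !exprD !exprMn !exprS.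
  by ring.
have [|u2 [s2 [Eu2 def_be]]] := @red_y i.+1 c (c + a.+1) (c + b.+1) be
   (g ^+ c * h ^+ c * (al * f ^+ a * g ^+ b.+1 + ga * h ^+ a.+1 * f ^+ b + g * h * v'))
   (ltn0Sn _).
  rewrite -Ek (_ : f ^+ c * _ = r) // def_r def_v !exprD !exprMn !exprS.
  by ring.
have [|u3 [s3 [Eu3 def_ga]]] := @red_z i.+1 c (c + a.+1) (c + b.+1) ga
   (f ^+ c * h ^+ c * (al * f ^+ a.+1 * g ^+ b + be * g ^+ a * h ^+ b.+1 + f * h * v'))
   (ltn0Sn _).
  rewrite -Ek (_ : g ^+ c * _ = r) // def_r def_v !exprD !exprMn !exprS.
  by ring.
have ik : (0 < i.+1 <= k)%N by [].
have [_ D _] := M_ideal.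
exists (coord_coef n k x y z i.+1 * u1 + coord_coef n k y z x i.+1 * u2
        + coord_coef n k z x y i.+1 * u3).
(* The leftovers h s1, f s2, g s3 each supply the factor missing from their monomial, so they become
   multiples of fgh and pass to the next level. *)
exists (s1 * (f ^+ a * g ^+ b) + s2 * (g ^+ a * h ^+ b) + s3 * (h ^+ a * f ^+ b) + v').
split.
- by apply: (D); [apply: (D); [apply: Mx | apply: My] | apply: Mz].
- have [_ ED EM] := ideal_exp_ideal (ideal_of_seq [:: f; g]) (k * (n - 3) + 3 * i).
  have Ef : pair_exp f g 1 f by apply/pair_exp1; exists 1, 0; ring.
  have Eg : pair_exp f g 1 g by apply/pair_exp1; exists 0, 1; ring.
  have Eh : pair_exp f g 1 h by apply/pair_exp1; exists (-1), (-1); ring.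
  (* In fact a + b exceeds the required exponent by one. *)
  have le : (k * (n - 3) + 3 * i <= a + b)%N by lia.
  have E p q : pair_exp f g 1 p -> pair_exp f g 1 q ->
      pair_exp f g (k * (n - 3) + 3 * i) (p ^+ a * q ^+ b).
    by move=> Ep Eq; apply: (pair_exp_le le); apply: pair_exp_monM.
  apply: (ED); last by apply: pair_exp_le Ev'; lia.
  by do 2?[apply: (ED)]; apply: (EM); apply: E.
- have -> : (k - i = c.+1)%N by rewrite /c; lia.
  rewrite def_r def_v def_al def_be def_ga /coord_coef Ea Eb -/c.
  by rewrite !exprD !exprMn !exprS; ring.
Qed.

Lemma descent i v r : (i <= k)%N ->
  pair_exp f g (k * (n - 3) + 3 * i) v -> r = (f * g * h) ^+ (k - i) * v ->
  [/\ pair_exp x y (k * n) r, pair_exp y z (k * n) r & pair_exp z x (k * n) r] ->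
  M r.
Proof.
elim: i v r => [|i IH] v r leik Ev def_r r_in.
  by rewrite def_r subn0; apply: M0; move: Ev; rewrite muln0 addn0 mulnC.
have [m [v' [Mm Ev' Erm]]] := descent_step leik Ev def_r r_in.
have [_ D _] := M_ideal; rewrite -(subrK m r); apply: (D) => //.
apply: (IH v') => //; first exact: ltnW.
(* The subtracted [m] has the required orders too, by [M_sub], so the remainder meets the hypotheses
   of the next step. *)
have [r1 r2 r3] := r_in; have [m1 m2 m3] := M_sub Mm.
by split; apply: idealB => //; apply: ideal_exp_ideal.
Qed.

Lemma generation r : pair_exp f g (k * n) r ->
  [/\ pair_exp x y (k * n) r, pair_exp y z (k * n) r & pair_exp z x (k * n) r] ->
  M r.
Proof.
move=> Er; apply: (descent (i := k) (v := r)) => //; last by rewrite subnn mul1r.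
rewrite (_ : k * (n - 3) + 3 * k = k * n)%N //.
by case: n n_ge3 => [|[|[|m]]] // _; rewrite !subSS subn0; lia.
Qed.

End Generation.

(** * The list of generators *)

Section IdealSums.
Variable R : comNzRingType.
Implicit Types (M : R -> Prop) (A : nat -> R -> Prop).

Lemma ideal_mul1P (c a b r : R) s :
  ideal_mul (ideal_of_seq [:: c]) (pair_exp a b s) r <->
  exists2 u, pair_exp a b s u & r = c * u.
Proof.
have [Z D N] := ideal_exp_ideal (ideal_of_seq [:: a; b]) s.
split=> [|[u Eu ->]]; last first.
  by apply: mem_ideal_gen; exists c, u; split=> //; apply: mem_ideal_gen; rewrite inE.
apply: (ideal_gen_sub (A := fun r => exists2 u, pair_exp a b s u & r = c * u)).
  split.
  - by exists 0; rewrite ?mulr0.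
  - by move=> _ _ [u Eu ->] [v Ev ->]; exists (u + v); rewrite ?mulrDr //; apply: D.
  - by move=> d _ [u Eu ->]; exists (d * u); [exact: N | rewrite mulrCA].
move=> _ [p [q [Ep Eq ->]]]; move: p Ep.
apply: ideal_gen_sub => [|p].
  split.
  - by exists 0; rewrite ?mulr0 ?mul0r.
  - move=> p p' [u Eu E] [v Ev E'].
    by exists (u + v); rewrite ?mulrDl ?mulrDr ?E ?E' //; apply: D.
  - by move=> d p [u Eu E]; exists (d * u); [exact: N | rewrite -mulrA E mulrCA].
by rewrite inE => /eqP->; exists q.
Qed.

Lemma big_ideal_add_ideal A m n : (forall i, is_ideal (A i)) ->
  is_ideal (\big[@ideal_add R/@ideal0 R]_(m <= i < n) A i).
Proof.
move=> Ai; apply: big_ind => [||i _]; [exact: ideal0_ideal | | exact: Ai].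
exact: ideal_add_ideal.
Qed.

Lemma big_ideal_add_sub A M m n : is_ideal M ->
  (forall i r, (m <= i < n)%N -> A i r -> M r) ->
  forall r, (\big[@ideal_add R/@ideal0 R]_(m <= i < n) A i) r -> M r.
Proof.
move=> [M0 MD _] AM; rewrite big_nat_cond.
apply: (big_ind (fun B : R -> Prop => forall r, B r -> M r)) => [r -> //||i].
  by move=> B C BM CM _ [b [c [/BM Mb /CM Mc ->]]]; apply: MD.
by rewrite andbT => lti r; apply: AM.
Qed.

Lemma mem_big_ideal_add A m n i r : (forall i, is_ideal (A i)) ->
  (m <= i < n)%N -> A i r -> (\big[@ideal_add R/@ideal0 R]_(m <= i < n) A i) r.
Proof.
move=> Ai /andP[lemi ltin] Ar.
have [d] : exists d, (n - m = d)%N by eexists.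
elim: d m lemi => [|d IH] m lemi Ed; first by lia.
rewrite big_ltn; last by lia.
have [eqmi|neqmi] := eqVneq i m.
  exists r, 0; rewrite addr0 -eqmi; split=> //.
  by case: (@big_ideal_add_ideal A i.+1 n Ai).
exists 0, r; rewrite add0r; split=> //; first by case: (Ai m).
by apply: IH; lia.
Qed.

Lemma pow_gens_ideal (G : seq R) (c a b : R) s :
  (forall j, (j <= s)%N -> c * (a ^+ (s - j) * b ^+ j) \in G) ->
  forall u, pair_exp a b s u -> ideal_of_seq G (c * u).
Proof.
move=> Gj; have [Z D N] := ideal_gen_ideal (fun r => r \in G).
apply: (pair_exp_ind (A := fun u => ideal_of_seq G (c * u))) => [|j lej].
  split=> [|p q Ep Eq|d p Ep]; first by rewrite mulr0.
    by rewrite mulrDr; apply: D.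
  by rewrite mulrCA; apply: N.
by apply/mem_ideal_gen/Gj.
Qed.

(** Independence is stated on indices rather than values. It also yields distinctness: if two
    indices gave the same element, one would be generated by the other. *)
Lemma minimal_generators_indep (T : eqType) (idx : seq T) (F : T -> R) J :
  uniq idx -> ideal_eq (ideal_of_seq (map F idx)) J ->
  (forall p, p \in idx ->
     ~ ideal_gen (fun r => exists q, [/\ q \in idx, q != p & r = F q]) (F p)) ->
  minimal_generators (map F idx) J.
Proof.
move=> Uidx GJ indep; split=> //.
  rewrite map_inj_in_uniq // => p q pidx qidx Epq; apply/eqP/negPn/negP => neq.
  by apply: (indep q qidx); apply: mem_ideal_gen; exists p.
move=> S SG SJ _ /mapP[p pidx ->]; apply: NNPP => notSp; apply: (indep p pidx).
have : ideal_gen S (F p).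
  by apply/SJ/GJ/mem_ideal_gen; apply: map_f.
apply: ideal_gen_sub => [|r Sr]; first exact: ideal_gen_ideal.
apply: mem_ideal_gen; have /mapP[q qidx Er] := SG r Sr; exists q; split=> //.
by apply/eqP => eqp; apply: notSp; rewrite -eqp -Er.
Qed.

End IdealSums.

Section PairPowerMembers.
Variable R : comNzRingType.
Implicit Types a b p q : R.

Lemma pair_exp_subX n a b : pair_exp a b n (a ^+ n - b ^+ n).
Proof.
apply: idealB; first exact: ideal_exp_ideal.
  by have := pair_exp_mon a b (leq0n n); rewrite subn0 mulr1.
by have := pair_exp_mon a b (leqnn n); rewrite subnn mul1r.
Qed.

Lemma pair_exp_mulr a b m p q : pair_exp a b m p -> pair_exp a b m (p * q).
Proof.
move=> Ep; rewrite mulrC.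
by case: (ideal_exp_ideal (ideal_of_seq [:: a; b]) m) => _ _; apply.
Qed.

End PairPowerMembers.

Section Generators.
Variables (R : comNzRingType) (n k : nat) (x y z : R).
Hypothesis n_ge3 : (3 <= n)%N.

Local Notation f := (y ^+ n - z ^+ n).
Local Notation g := (z ^+ n - x ^+ n).
Local Notation h := (x ^+ n - y ^+ n).

Lemma coord_coef_y i : coord_coef n k y z x i =
  f ^+ (k - i) * g ^+ ((k - i) * (n - 2) + 2 * i) * h ^+ (k + i * (n - 3))
  * y ^+ ((i - 1) * n + 1).
Proof. by rewrite /coord_coef; ring. Qed.

Lemma coord_coef_z i : coord_coef n k z x y i =
  f ^+ (k + i * (n - 3)) * g ^+ (k - i) * h ^+ ((k - i) * (n - 2) + 2 * i)
  * z ^+ ((i - 1) * n + 1).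
Proof. by rewrite /coord_coef; ring. Qed.

Lemma coord_coef_dvd i : (i <= k)%N ->
  [/\ exists s, coord_coef n k x y z i = f ^+ k * s,
      exists s, coord_coef n k x y z i = g ^+ k * s &
      exists s, coord_coef n k x y z i = h ^+ (k - i) * s].
Proof.
move=> leik; rewrite /coord_coef.
have le : (k <= (k - i) * (n - 2) + 2 * i)%N.
  by case: n n_ge3 => [|[|[|m]]] // _; rewrite !subSS !subn0; nia.
split.
- exists (f ^+ ((k - i) * (n - 2) + 2 * i - k) * g ^+ (k + i * (n - 3))
    * h ^+ (k - i) * x ^+ ((i - 1) * n + 1)).
  by rewrite -[in LHS](subnK le) exprD; ring.
- exists (f ^+ ((k - i) * (n - 2) + 2 * i) * g ^+ (i * (n - 3))
    * h ^+ (k - i) * x ^+ ((i - 1) * n + 1)).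
  by rewrite [g ^+ (k + _)]exprD; ring.
- exists (f ^+ ((k - i) * (n - 2) + 2 * i) * g ^+ (k + i * (n - 3))
    * x ^+ ((i - 1) * n + 1)).
  by ring.
Qed.

(** In an index (t, i, j), t selects the family, i the level and j the monomial; the family of
    (fgh)^k has t = 0 and is placed at level 0, so that the degree is n(kn+i) throughout. *)
Definition gen (p : nat * nat * nat) : R :=
  let: (t, i, j) := p in
  if t is t'.+1 then
    if t' is t''.+1 then
      if t'' is 0%N then coord_coef n k y z x i * (y ^+ (n - 1 - j) * z ^+ j)
      else coord_coef n k z x y i * (z ^+ (n - 1 - j) * x ^+ j)
    else coord_coef n k x y z i * (x ^+ (n - 1 - j) * y ^+ j)
  else (f * g * h) ^+ k * (f ^+ ((n - 3) * k - j) * g ^+ j).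

Definition gen_idx : seq (nat * nat * nat) :=
  [seq (0%N, 0%N, j) | j <- iota 0 ((n - 3) * k).+1]
  ++ [seq (1%N, i, j) | i <- iota 1 k, j <- iota 0 (n - 1).+1]
  ++ [seq (2%N, i, j) | i <- iota 1 k, j <- iota 0 (n - 1).+1]
  ++ [seq (3%N, i, j) | i <- iota 1 k, j <- iota 0 (n - 1).+1].

Lemma mem_gen_idx t i j : ((t, i, j) \in gen_idx) =
  if t is 0%N then (i == 0%N) && (j <= (n - 3) * k)%N
  else [&& (t <= 3)%N, (0 < i <= k)%N & (j <= n - 1)%N].
Proof.
have mem0 : ((t, i, j) \in [seq (0%N, 0%N, l) | l <- iota 0 ((n - 3) * k).+1])
    = [&& t == 0%N, i == 0%N & (j <= (n - 3) * k)%N].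
  apply/mapP/idP => [[l + [-> -> ->]]|/and3P[/eqP-> /eqP-> lej]].
    by rewrite mem_iota.
  by exists j; rewrite // mem_iota.
have memS s : ((t, i, j) \in [seq (s, i, j) | i <- iota 1 k, j <- iota 0 (n - 1).+1])
    = [&& t == s, (0 < i <= k)%N & (j <= n - 1)%N].
  apply/allpairsP/idP => [[[i' j'] [+ + [-> -> ->]]]|/and3P[/eqP-> ltik lej]].
    by rewrite !mem_iota add1n !ltnS eqxx /= => -> ->.
  by exists (i, j); rewrite !mem_iota add1n !ltnS.
rewrite !mem_cat mem0 !memS.
by case: t {mem0 memS} => [|[|[|[|t]]]]; rewrite //= ?orbF.
Qed.

Lemma gen_idx_uniq : uniq gen_idx.
Proof.
have uS (s : nat) : uniq [seq (s, i, j) | i <- iota 1 k, j <- iota 0 (n - 1).+1].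
  by apply: allpairs_uniq => [||[i j] [i' j'] _ _ [-> ->]] //; apply: iota_uniq.
have disj (s t : nat) : s != t ->
    has (mem [seq (s, i, j) | i <- iota 1 k, j <- iota 0 (n - 1).+1])
        [seq (t, i, j) | i <- iota 1 k, j <- iota 0 (n - 1).+1] = false.
  move=> neq_st; apply/hasPn => _ /allpairsP[[i j] [_ _ ->]].
  by apply/allpairsP => -[[i' j'] [_ _ [Est]]]; rewrite Est eqxx in neq_st.
have disj0 (t : nat) : t != 0%N ->
    has (mem [seq (0%N, 0%N, j) | j <- iota 0 ((n - 3) * k).+1])
        [seq (t, i, j) | i <- iota 1 k, j <- iota 0 (n - 1).+1] = false.
  move=> neq_t; apply/hasPn => _ /allpairsP[[i j] [_ _ ->]].
  by apply/mapP => -[j' _ [Et]]; rewrite Et eqxx in neq_t.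
have u0 : uniq [seq (0%N, 0%N, j) | j <- iota 0 ((n - 3) * k).+1].
  by rewrite map_inj_uniq ?iota_uniq // => j j' [].
by rewrite !cat_uniq !has_cat u0 !uS !disj ?disj0.
Qed.

(** Spelled out as in the theorem, so that the two lists are convertible. *)
Definition fermat_gens : seq R :=
  let c1 i := f ^+ ((k - i) * (n - 2) + 2 * i) * g ^+ (k + i * (n - 3))
              * h ^+ (k - i) * x ^+ ((i - 1) * n + 1) in
  let c2 i := f ^+ (k - i) * g ^+ ((k - i) * (n - 2) + 2 * i)
              * h ^+ (k + i * (n - 3)) * y ^+ ((i - 1) * n + 1) in
  let c3 i := f ^+ (k + i * (n - 3)) * g ^+ (k - i)
              * h ^+ ((k - i) * (n - 2) + 2 * i) * z ^+ ((i - 1) * n + 1) in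
  [seq (f * g * h) ^+ k * u | u <- pow_gens f g ((n - 3) * k)]
    ++ [seq c1 i * u | i <- iota 1 k, u <- pow_gens x y (n - 1)]
    ++ [seq c2 i * u | i <- iota 1 k, u <- pow_gens y z (n - 1)]
    ++ [seq c3 i * u | i <- iota 1 k, u <- pow_gens z x (n - 1)].

Lemma fermat_gensE : fermat_gens = map gen gen_idx.
Proof.
have Emap (c : nat -> R) (F : nat -> R) (s : seq nat) t :
    (forall i j, gen (t, i, j) = c i * F j) ->
    [seq c i * u | i <- iota 1 k, u <- map F s] =
    map gen [seq (t, i, j) | i <- iota 1 k, j <- s].
  move=> E; rewrite allpairs_mapr map_allpairs.
  by apply: eq_allpairs => i j; rewrite E.
rewrite /fermat_gens /gen_idx !map_cat /pow_gens; congr (_ ++ (_ ++ (_ ++ _))).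
- by rewrite -!map_comp.
- exact: Emap.
- by apply: Emap => i j; rewrite -coord_coef_y.
- by apply: Emap => i j; rewrite -coord_coef_z.
Qed.

Lemma mem_gens p : p \in gen_idx -> gen p \in fermat_gens.
Proof. by move=> pidx; rewrite fermat_gensE; apply: map_f. Qed.

Definition fermat_sum : R -> Prop :=
  let c1 i := f ^+ ((k - i) * (n - 2) + 2 * i) * g ^+ (k + i * (n - 3))
              * h ^+ (k - i) * x ^+ ((i - 1) * n + 1) in
  let c2 i := f ^+ (k - i) * g ^+ ((k - i) * (n - 2) + 2 * i)
              * h ^+ (k + i * (n - 3)) * y ^+ ((i - 1) * n + 1) in
  let c3 i := f ^+ (k + i * (n - 3)) * g ^+ (k - i)
              * h ^+ ((k - i) * (n - 2) + 2 * i) * z ^+ ((i - 1) * n + 1) in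
  let term c a b s :=
    ideal_mul (ideal_of_seq [:: c]) (ideal_exp (ideal_of_seq [:: a; b]) s) in
  let sum_terms c a b :=
    \big[@ideal_add _/@ideal0 _]_(1 <= i < k.+1) term (c i) a b (n - 1)%N in
  ideal_add (term ((f * g * h) ^+ k) f g ((n - 3) * k)%N)
      (ideal_add (sum_terms c1 x y)
        (ideal_add (sum_terms c2 y z) (sum_terms c3 z x))).

Let M := ideal_of_seq fermat_gens.
Let M_ideal : is_ideal M := ideal_gen_ideal _.

Lemma gens_ideal0 u : pair_exp f g ((n - 3) * k) u -> M ((f * g * h) ^+ k * u).
Proof.
by apply: pow_gens_ideal => j lej;
   apply: (mem_gens (p := (0%N, 0%N, j))); rewrite mem_gen_idx.
Qed.

Lemma gens_ideal1 i u : (0 < i <= k)%N -> pair_exp x y (n - 1) u ->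
  M (coord_coef n k x y z i * u).
Proof.
by move=> ltik; apply: pow_gens_ideal => j lej;
   apply: (mem_gens (p := (1%N, i, j))); rewrite mem_gen_idx ltik.
Qed.

Lemma gens_ideal2 i u : (0 < i <= k)%N -> pair_exp y z (n - 1) u ->
  M (coord_coef n k y z x i * u).
Proof.
by move=> ltik; apply: pow_gens_ideal => j lej;
   apply: (mem_gens (p := (2%N, i, j))); rewrite mem_gen_idx ltik.
Qed.

Lemma gens_ideal3 i u : (0 < i <= k)%N -> pair_exp z x (n - 1) u ->
  M (coord_coef n k z x y i * u).
Proof.
by move=> ltik; apply: pow_gens_ideal => j lej;
   apply: (mem_gens (p := (3%N, i, j))); rewrite mem_gen_idx ltik.
Qed.

Lemma fermat_sumE : ideal_eq M fermat_sum.
Proof.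
have sub_sum (c : nat -> R) a b :
    (forall i u, (0 < i <= k)%N -> pair_exp a b (n - 1) u -> M (c i * u)) ->
    forall r, (\big[@ideal_add R/@ideal0 R]_(1 <= i < k.+1)
       ideal_mul (ideal_of_seq [:: c i]) (pair_exp a b (n - 1))) r -> M r.
  move=> cM; apply: big_ideal_add_sub => // i r ltik /ideal_mul1P[u Eu ->].
  exact: cM.
have term_ideal (c a b : R) s : is_ideal (ideal_mul (ideal_of_seq [:: c]) (pair_exp a b s)).
  exact: ideal_gen_ideal.
have sum_ideal (c : nat -> R) a b : is_ideal (\big[@ideal_add R/@ideal0 R]_(1 <= i < k.+1)
       ideal_mul (ideal_of_seq [:: c i]) (pair_exp a b (n - 1))).
  by apply: big_ideal_add_ideal => i; apply: term_ideal.
have mem_sum (c : nat -> R) a b i j : (0 < i <= k)%N -> (j <= n - 1)%N ->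
    (\big[@ideal_add R/@ideal0 R]_(1 <= i < k.+1)
       ideal_mul (ideal_of_seq [:: c i]) (pair_exp a b (n - 1)))
    (c i * (a ^+ (n - 1 - j) * b ^+ j)).
  move=> ltik lej; apply: (mem_big_ideal_add (i := i)) => //.
  by apply/ideal_mul1P; exists (a ^+ (n - 1 - j) * b ^+ j) => //; apply: pair_exp_mon.
have addl (A B : R -> Prop) r : is_ideal B -> A r -> ideal_add A B r.
  by move=> [B0 _ _] Ar; exists r, 0; rewrite addr0.
have addr (A B : R -> Prop) r : is_ideal A -> B r -> ideal_add A B r.
  by move=> [A0 _ _] Br; exists 0, r; rewrite add0r.
move=> r; split=> [|[r0 [_ [/ideal_mul1P[u Eu ->]
    [r1 [_ [Er1 [r2 [r3 [Er2 Er3 ->]]] ->]]] ->]]]].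
  have sum23 := ideal_add_ideal (sum_ideal (coord_coef n k y z x) y z)
    (sum_ideal (coord_coef n k z x y) z x).
  have sum123 := ideal_add_ideal (sum_ideal (coord_coef n k x y z) x y) sum23.
  rewrite /fermat_sum /=.
  rewrite -(eq_bigr _ (fun i _ => congr1 (fun c =>
    ideal_mul (ideal_of_seq [:: c]) (pair_exp y z (n - 1))) (coord_coef_y i))).
  rewrite -(eq_bigr _ (fun i _ => congr1 (fun c =>
    ideal_mul (ideal_of_seq [:: c]) (pair_exp z x (n - 1))) (coord_coef_z i))).
  apply: ideal_gen_sub; first exact: (ideal_add_ideal (term_ideal _ _ _ _) sum123).
  move=> s; rewrite fermat_gensE => /mapP[[[t i] j]].
  rewrite mem_gen_idx; case: t => [|[|[|[|t]]]] //.
  - move=> /andP[_ lej] ->; apply: (addl) => //; apply/ideal_mul1P.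
    by exists (f ^+ ((n - 3) * k - j) * g ^+ j) => //; apply: pair_exp_mon.
  - move=> /and3P[_ ltik lej] ->; apply: (addr) => //; apply: (addl) => //.
    exact: mem_sum.
  - move=> /and3P[_ ltik lej] ->; apply: (addr) => //; apply: (addr) => //.
    by apply: (addl) => //; apply: mem_sum.
  - move=> /and3P[_ ltik lej] ->; apply: (addr) => //; apply: (addr) => //.
    by apply: (addr) => //; apply: mem_sum.
have [_ D _] := M_ideal.
apply: (D); first exact: gens_ideal0.
apply: (D); first by apply: sub_sum Er1; apply: gens_ideal1.
apply: (D).
  apply: sub_sum Er2 => i v ltik Ev.
  by rewrite -coord_coef_y; apply: gens_ideal2.
apply: sub_sum Er3 => i v ltik Ev.
by rewrite -coord_coef_z; apply: gens_ideal3.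
Qed.

(** Two counts are sharp: the exponents of f, g, h add up to kn, and at (x, y) the order is (k-i)n +
    ((i-1)n+1) + (n-1) = kn. At the other two coordinate points f^k and g^k suffice. *)
Lemma coord_coef_pair i u : (0 < i <= k)%N -> pair_exp x y (n - 1) u ->
  [/\ pair_exp f g (k * n) (coord_coef n k x y z i * u),
      pair_exp x y (k * n) (coord_coef n k x y z i * u),
      pair_exp y z (k * n) (coord_coef n k x y z i * u) &
      pair_exp z x (k * n) (coord_coef n k x y z i * u)].
Proof.
move=> /andP[i_gt0 leik] Eu.
have [[sf Ef] [sg Eg] [sh Eh]] := coord_coef_dvd leik.
split.
- rewrite /coord_coef -mulrA; apply: pair_exp_mulr.
  have Pf : pair_exp f g 1 f by apply/pair_exp1; exists 1, 0; ring.
  have Pg : pair_exp f g 1 g by apply/pair_exp1; exists 0, 1; ring.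
  have Ph : pair_exp f g 1 h by apply/pair_exp1; exists (-1), (-1); ring.
  have E := pair_expM (pair_exp_monM ((k - i) * (n - 2) + 2 * i) (k + i * (n - 3)) Pf Pg)
    (pair_expX (k - i) Ph).
  apply: pair_exp_le E; case: n n_ge3 => [|[|[|m]]] // _; rewrite !subSS !subn0.
  by rewrite -[k in (k * _)%N](subnK leik); nia.
- have Ex : pair_exp x y 1 x by apply/pair_exp1; exists 1, 0; ring.
  have E := pair_expM (pair_expX (k - i) (pair_exp_subX n x y))
    (pair_expM (pair_expX ((i - 1) * n + 1) Ex) Eu).
  have -> : coord_coef n k x y z i * u = h ^+ (k - i) * (x ^+ ((i - 1) * n + 1) * u)
      * (f ^+ ((k - i) * (n - 2) + 2 * i) * g ^+ (k + i * (n - 3))).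
    by rewrite /coord_coef; ring.
  apply: pair_exp_mulr; apply: pair_exp_le E.
  case: i i_gt0 leik {Ef Eg Eh} => // i _ leik; rewrite subSS subn0.
  rewrite -[k in (k * _)%N](subnK leik) mulnDl mulSn; lia.
- by rewrite Ef -mulrA; apply/pair_exp_mulr/pair_expX/pair_exp_subX.
- by rewrite Eg -mulrA; apply/pair_exp_mulr/pair_expX/pair_exp_subX.
Qed.

Lemma base_coef_pair u : pair_exp f g ((n - 3) * k) u ->
  [/\ pair_exp f g (k * n) ((f * g * h) ^+ k * u),
      pair_exp x y (k * n) ((f * g * h) ^+ k * u),
      pair_exp y z (k * n) ((f * g * h) ^+ k * u) &
      pair_exp z x (k * n) ((f * g * h) ^+ k * u)].
Proof.
move=> Eu.
split.
- have Pf : pair_exp f g 1 f by apply/pair_exp1; exists 1, 0; ring.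
  have Pg : pair_exp f g 1 g by apply/pair_exp1; exists 0, 1; ring.
  have Ph : pair_exp f g 1 h by apply/pair_exp1; exists (-1), (-1); ring.
  have E := pair_expM (pair_expX k (pair_expM (pair_expM Pf Pg) Ph)) Eu.
  by apply: pair_exp_le E; case: n n_ge3 => [|[|[|m]]] // _; rewrite !subSS subn0; lia.
- rewrite mulrC [_ ^+ k]exprMn mulrA mulrC; apply: pair_exp_mulr; apply: pair_expX.
  exact: pair_exp_subX.
- rewrite !exprMn -!mulrA; apply: pair_exp_mulr; apply: pair_expX; exact: pair_exp_subX.
- by rewrite !exprMn -!mulrA mulrCA; apply/pair_exp_mulr/pair_expX/pair_exp_subX.
Qed.

End Generators.

(** * Grading *)

Section Grading.
Variables (K : fieldType) (n : nat).
Local Notation R := {mpoly K[n]}.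

Definition scale : {rmorphism R -> {poly R}} :=
  mmap (polyC \o @mpolyC n K) (fun i => 'X * ('X_i)%:P).

(** Homogeneity expressed through the substitution of X times each variable; 0 has every degree. *)
Definition homdeg d (r : R) := scale r = 'X^d * r%:P.

Lemma homdegX i : homdeg 1 'X_i.
Proof. by rewrite /homdeg /scale /= mmapX mmap1U. Qed.

Lemma homdegM d e r s : homdeg d r -> homdeg e s -> homdeg (d + e) (r * s).
Proof. by rewrite /homdeg rmorphM => -> ->; rewrite rmorphM exprD mulrACA. Qed.

Lemma homdeg_exp d e r : homdeg d r -> homdeg (e * d) (r ^+ e).
Proof.
move=> Hr; elim: e => [|e IH]; first by rewrite /homdeg rmorph1 mulr1.
by rewrite exprS mulSn; apply: homdegM.
Qed.

Lemma homdegB d r s : homdeg d r -> homdeg d s -> homdeg d (r - s).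
Proof. by rewrite /homdeg rmorphB => -> ->; rewrite -mulrBr rmorphB. Qed.

Lemma homdeg0 d : homdeg d 0.
Proof. by rewrite /homdeg !rmorph0 mulr0. Qed.

Lemma homdeg_coef d r : homdeg d r -> (scale r)`_d = r.
Proof. by move=> ->; rewrite coefXnM ltnn subnn coefC. Qed.

Lemma scale_coef0 r : exists k : K, (scale r)`_0 = k%:MP.
Proof.
elim/mpoly_ring_ind: r => [k|i|p q [k Ek] [l El]|p q [k Ek] [l El]].
- by exists k; rewrite /scale /= mmapC /= coefC.
- by exists 0; rewrite homdegX expr1 coefXM rmorph0.
- by exists (k + l); rewrite rmorphD coefD mpolyCD -Ek -El.
- by exists (k * l); rewrite rmorphM coef0M mpolyCM -Ek -El.
Qed.

Lemma homdeg_part_span (S : R -> Prop) (B : nat -> R) (H r : R) N d j :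
  (j < N)%N -> (forall i, (i < N)%N -> homdeg d (B i)) ->
  (exists e, homdeg e H) ->
  (forall s, S s -> [\/ exists t, s = H * t,
     exists2 e, (d < e)%N & homdeg e s |
     exists2 i, (i < N)%N && (i != j) & s = B i]) ->
  ideal_gen S r -> exists (nu : nat -> K) (w : R), nu j = 0 /\
    (scale r)`_d = \sum_(i < N) (nu i)%:MP * B i + H * w.
Proof.
move=> ltjN HB [eH HH] S_cases [t [St ->]].
rewrite rmorph_sum coef_sum big_seq.
apply: (big_ind (fun q : R => exists (nu : nat -> K) (w : R), nu j = 0 /\
    q = \sum_(i < N) (nu i)%:MP * B i + H * w)).
- exists (fun=> 0), 0; split=> //; rewrite mulr0 addr0 big1 // => i _.
  by rewrite mpolyC0 mul0r.
- move=> _ _ [nu [w [Ej ->]]] [nu' [w' [Ej' ->]]].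
  exists (fun i => nu i + nu' i), (w + w'); rewrite Ej Ej' addr0; split=> //.
  under [in RHS]eq_bigr => i _ do rewrite mpolyCD mulrDl.
  by rewrite big_split mulrDr addrACA.
move=> c /St/S_cases[[u ->]|[e ltde He]|[i /andP[ltiN neq_ij] ->]].
- exists (fun=> 0), ('X^eH * scale (c.1 * u))`_d; split=> //.
  rewrite big1 => [|i _]; last by rewrite mpolyC0 mul0r.
  by rewrite add0r mulrCA rmorphM HH -mulrA (mulrCA _ H%:P) coefCM.
- exists (fun=> 0), 0; split=> //.
  rewrite big1 => [|i _]; last by rewrite mpolyC0 mul0r.
  by rewrite mulr0 addr0 rmorphM He mulrCA coefXnM ltde.
- have [k Ek] := scale_coef0 c.1.
  exists (fun i' => if (i' == i)%N then k else 0), 0.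
  rewrite eq_sym (negPf neq_ij); split=> //.
  rewrite (bigD1 (Ordinal ltiN)) //= eqxx big1 => [|i' neq].
    by rewrite mulr0 !addr0 rmorphM (HB _ ltiN) mulrCA coefXnM ltnn subnn coefMC Ek.
  rewrite (_ : (i' == i :> nat) = false) ?mpolyC0 ?mul0r //.
  by apply: contraNF neq => /eqP E; apply/eqP/val_inj.
Qed.

Lemma homdeg_independent (S : R -> Prop) (B : nat -> R) (H : R) N d j :
  (j < N)%N -> (forall i, (i < N)%N -> homdeg d (B i)) ->
  (exists e, homdeg e H) ->
  (forall s, S s -> [\/ exists t, s = H * t,
     exists2 e, (d < e)%N & homdeg e s |
     exists2 i, (i < N)%N && (i != j) & s = B i]) ->
  ideal_gen S (B j) -> exists (nu : nat -> K) (w : R), nu j = 1 /\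
    \sum_(i < N) (nu i)%:MP * B i = H * w.
Proof.
move=> ltjN HB HH S_cases Sj.
have [nu [w [nuj E]]] := homdeg_part_span ltjN HB HH S_cases Sj.
exists (fun i => (if (i == j)%N then 1 else 0) - nu i), w; rewrite eqxx nuj subr0.
split=> //; rewrite (eq_bigr (fun i : 'I_N =>
    (if (i == j :> nat)%N then B i else 0) - (nu i)%:MP * B i)) => [|i _].
  rewrite sumrB -big_mkcond (big_pred1 (Ordinal ltjN)) //= -{1}(homdeg_coef (HB _ ltjN)) E.
  by rewrite addrAC subrr add0r.
by rewrite mpolyCB mulrBl; case: eqP; rewrite ?mpolyC1 ?mul1r ?mpolyC0 ?mul0r.
Qed.

End Grading.

Section HomogeneousGenerators.
Variables (K : fieldType) (m n k : nat) (x y z : {mpoly K[m]}).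
Hypothesis n_ge3 : (3 <= n)%N.
Hypotheses (Hx : homdeg 1 x) (Hy : homdeg 1 y) (Hz : homdeg 1 z).

Local Notation f := (y ^+ n - z ^+ n).
Local Notation g := (z ^+ n - x ^+ n).
Local Notation h := (x ^+ n - y ^+ n).

Lemma homdeg_subX (u v : {mpoly K[m]}) :
  homdeg 1 u -> homdeg 1 v -> homdeg n (u ^+ n - v ^+ n).
Proof.
by move=> Hu Hv; apply: homdegB; rewrite -[n in homdeg n _]muln1; apply: homdeg_exp.
Qed.

(** The kn factors among f, g, h contribute n(kn), and the variables contribute ((i-1)n+1) + (n-1) =
    in. *)
Lemma homdeg_coord_coef i u v j : (0 < i <= k)%N -> (j <= n - 1)%N ->
  homdeg 1 u -> homdeg 1 v ->
  homdeg (n * (k * n + i)) (coord_coef n k x y z i * (u ^+ (n - 1 - j) * v ^+ j)).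
Proof.
move=> /andP[i_gt0 leik] lej Hu Hv.
have H := homdegM (homdegM (homdegM (homdegM
  (homdeg_exp ((k - i) * (n - 2) + 2 * i) (homdeg_subX Hy Hz))
  (homdeg_exp (k + i * (n - 3)) (homdeg_subX Hz Hx)))
  (homdeg_exp (k - i) (homdeg_subX Hx Hy)))
  (homdeg_exp ((i - 1) * n + 1) Hx))
  (homdegM (homdeg_exp (n - 1 - j) Hu) (homdeg_exp j Hv)).
move: H; set d := (X in homdeg X _) => H; rewrite (_ : n * (k * n + i) = d)%N //.
rewrite /d !muln1; have -> : (n - 1 - j + j = n - 1)%N by lia.
case: i i_gt0 leik {H d} => // i _ leik; rewrite subSS subn0.
have [c ->] : exists c, (k = c + i.+1)%N by exists (k - i.+1)%N; lia.
rewrite addnK; case: n n_ge3 => [|[|[|l]]] // _.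
rewrite !subSS !subn0; nia.
Qed.

Lemma homdeg_base j : (j <= (n - 3) * k)%N ->
  homdeg (n * (k * n)) ((f * g * h) ^+ k * (f ^+ ((n - 3) * k - j) * g ^+ j)).
Proof.
move=> lej.
have H := homdegM (homdeg_exp k (homdegM (homdegM (homdeg_subX Hy Hz) (homdeg_subX Hz Hx))
    (homdeg_subX Hx Hy)))
  (homdegM (homdeg_exp ((n - 3) * k - j) (homdeg_subX Hy Hz))
    (homdeg_exp j (homdeg_subX Hz Hx))).
move: H; set d := (X in homdeg X _) => H; rewrite (_ : n * (k * n) = d)%N //.
rewrite /d -mulnDl subnK //.
by case: n n_ge3 => [|[|[|l]]] // _; rewrite !subSS !subn0; nia.
Qed.

End HomogeneousGenerators.

(** * Minimality *)

Lemma mul_form_monomial (R : comNzRingType) (u t v : R) m l : (l <= m)%N ->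
  u ^+ m * (t ^+ l * v) = v * (u ^+ (m - l) * (t * u) ^+ l).
Proof. by move=> lelm; rewrite -{1}(subnK lelm) exprD exprMn; ring. Qed.

Section Divisibility.
Variables (R : comNzRingType) (n k : nat) (x y z : R).
Hypothesis n_ge3 : (3 <= n)%N.
Local Notation f := (y ^+ n - z ^+ n).
Local Notation g := (z ^+ n - x ^+ n).
Local Notation h := (x ^+ n - y ^+ n).

(** As i is positive, k is at least k-i+1, so f^k and g^k are enough; for h the exponent k-i' is
    enough once i' < i. After rotation this covers every family against every other. *)
Lemma coord_coef_dvdS i i' v : (0 < i <= k)%N -> (i' <= k)%N ->
  [/\ exists t, coord_coef n k x y z i' * v = f ^+ (k - i).+1 * t,
      exists t, coord_coef n k x y z i' * v = g ^+ (k - i).+1 * t &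
      (i' < i)%N -> exists t, coord_coef n k x y z i' * v = h ^+ (k - i).+1 * t].
Proof.
move=> /andP[i_gt0 leik] lei'k.
have dvd (p s : R) e : ((k - i).+1 <= e)%N ->
    exists t, p ^+ e * s * v = p ^+ (k - i).+1 * t.
  by move=> le; exists (p ^+ (e - (k - i).+1) * s * v); rewrite !mulrA -exprD subnKC.
have [[p ->] [q Eq] [r Er]] := coord_coef_dvd x y z n_ge3 lei'k.
split; first by apply: dvd; lia.
  by have := dvd g q k; rewrite -Eq => -[|t Et]; [lia | exists t; rewrite -Et].
move=> lti; have := dvd h r (k - i')%N; rewrite -Er.
by move=> -[|t Et]; [lia | exists t; rewrite -Et].
Qed.

Lemma base_dvdS i v : (0 < i <= k)%N ->
  [/\ exists t, (f * g * h) ^+ k * v = f ^+ (k - i).+1 * t,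
      exists t, (f * g * h) ^+ k * v = g ^+ (k - i).+1 * t &
      exists t, (f * g * h) ^+ k * v = h ^+ (k - i).+1 * t].
Proof.
move=> ltik; have Ek (p : R) : p ^+ k = p ^+ (k - i).+1 * p ^+ (i - 1).
  by rewrite -exprD; congr (p ^+ _); lia.
rewrite !exprMn; split.
- by exists (f ^+ (i - 1) * g ^+ k * h ^+ k * v); rewrite (Ek f); ring.
- by exists (g ^+ (i - 1) * f ^+ k * h ^+ k * v); rewrite (Ek g); ring.
- by exists (h ^+ (i - 1) * f ^+ k * g ^+ k * v); rewrite (Ek h); ring.
Qed.

End Divisibility.

Lemma gens_pair (R : comNzRingType) n k (x y z : R) r :
  (3 <= n)%N -> ideal_of_seq (fermat_gens n k x y z) r ->
  [/\ pair_exp (y ^+ n - z ^+ n) (z ^+ n - x ^+ n) (k * n) r,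
      pair_exp x y (k * n) r, pair_exp y z (k * n) r & pair_exp z x (k * n) r].
Proof.
move=> n_ge3; set f := y ^+ n - z ^+ n; set g := z ^+ n - x ^+ n => Mr.
suff H s : s \in fermat_gens n k x y z -> [/\ pair_exp f g (k * n) s,
      pair_exp x y (k * n) s, pair_exp y z (k * n) s & pair_exp z x (k * n) s].
  by split; apply: ideal_gen_sub Mr => [|s /H[]] //; apply: ideal_exp_ideal.
have Pf : pair_exp f g 1 f by apply/pair_exp1; exists 1, 0; ring.
have Pg : pair_exp f g 1 g by apply/pair_exp1; exists 0, 1; ring.
have Ph : pair_exp f g 1 (x ^+ n - y ^+ n).
  by apply/pair_exp1; exists (-1), (-1); rewrite /f /g; ring.
rewrite fermat_gensE => /mapP[[[t i] j]].
rewrite mem_gen_idx; case: t => [|[|[|[|t]]]] //.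
- move=> /andP[_ lej] ->; apply: base_coef_pair => //.
  exact: pair_exp_mon.
- move=> /and3P[_ ltik lej] ->; apply: coord_coef_pair => //.
  exact: pair_exp_mon.
- move=> /and3P[_ ltik lej] ->.
  have [E1 E2 E3 E4] := @coord_coef_pair R n k y z x n_ge3 i _ ltik (pair_exp_mon y z lej).
  by split=> //; apply: pair_exp_sub E1.
- move=> /and3P[_ ltik lej] ->.
  have [E1 E2 E3 E4] := @coord_coef_pair R n k z x y n_ge3 i _ ltik (pair_exp_mon z x lej).
  by split=> //; apply: pair_exp_sub E1.
Qed.

Lemma gens_generation (R : comNzRingType) n k (x y z : R) r : (3 <= n)%N ->
  reducible n x y z -> reducible n y z x -> reducible n z x y ->
  pair_exp (y ^+ n - z ^+ n) (z ^+ n - x ^+ n) (k * n) r ->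
  pair_exp x y (k * n) r -> pair_exp y z (k * n) r -> pair_exp z x (k * n) r ->
  ideal_of_seq (fermat_gens n k x y z) r.
Proof.
move=> n_ge3 red_x red_y red_z fg_r xy_r yz_r zx_r.
apply: (@generation R n k x y z n_ge3 red_x red_y red_z
  (ideal_of_seq (fermat_gens n k x y z))) => //.
- exact: ideal_gen_ideal.
- exact: gens_ideal0.
- exact: gens_ideal1.
- exact: gens_ideal2.
- exact: gens_ideal3.
- by move=> s /(gens_pair n_ge3)[].
Qed.

Section Relations.
Variables (R : idomainType) (n k : nat) (x y z : R).
Local Notation f := (y ^+ n - z ^+ n).
Local Notation g := (z ^+ n - x ^+ n).
Local Notation h := (x ^+ n - y ^+ n).

(** Once h^(k-i) is cancelled, the right side is still divisible by h. A morphism that kills h but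
    not f, g, x then leaves a relation among the monomials alone. *)
Lemma coord_relation (S : idomainType) (psi : {rmorphism R -> S}) i (nu : nat -> R) w :
  h != 0 -> psi f != 0 -> psi g != 0 -> psi h = 0 -> psi x != 0 ->
  \sum_(j < n) nu j * (coord_coef n k x y z i * (x ^+ (n - 1 - j) * y ^+ j))
    = h ^+ (k - i).+1 * w ->
  \sum_(j < n) psi (nu j) * (psi x ^+ (n - 1 - j) * psi y ^+ j) = 0.
Proof.
move=> h0 f0 g0 ph x0 E.
pose q := f ^+ ((k - i) * (n - 2) + 2 * i) * g ^+ (k + i * (n - 3))
  * x ^+ ((i - 1) * n + 1).
have Eq : q * (\sum_(j < n) nu j * (x ^+ (n - 1 - j) * y ^+ j)) = h * w.
  apply: (mulfI (expf_neq0 (k - i) h0)); rewrite [RHS]mulrA -exprSr -E !mulr_sumr.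
  by apply: eq_bigr => j _; rewrite /coord_coef /q; ring.
have /eqP := congr1 psi Eq; rewrite !rmorphM ph mul0r !rmorphXn !mulf_eq0 !expf_eq0.
rewrite (negPf f0) (negPf g0) (negPf x0) !andbF /= rmorph_sum => /eqP E0.
by rewrite -[RHS]E0; apply: eq_bigr => j _; rewrite !rmorphM !rmorphXn.
Qed.

(** At x = X, y = 1, z = 0 one gets f = 1 and g = -X^n, so the coefficient of X^(nj) isolates [nu j]
    up to sign. The product [0 * w] is the form delivered by [homdeg_independent] with [H] = 0. *)
Lemma base_relation (F : idomainType) (rho : {rmorphism R -> {poly F}})
    s (nu : nat -> F) (nuR : nat -> R) w :
  (0 < n)%N -> f != 0 -> g != 0 -> h != 0 ->
  rho x = 'X -> rho y = 1 -> rho z = 0 ->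
  (forall j, rho (nuR j) = (nu j)%:P) ->
  \sum_(j < s.+1) nuR j * ((f * g * h) ^+ k * (f ^+ (s - j) * g ^+ j)) = 0 * w ->
  forall j, (j <= s)%N -> nu j = 0.
Proof.
move=> n_gt0 f0 g0 h0 Ex Ey Ez rho_nu E j lejs.
have fgh0 : (f * g * h) ^+ k != 0 by rewrite expf_neq0 // !mulf_neq0.
have Eq : \sum_(j < s.+1) nuR j * (f ^+ (s - j) * g ^+ j) = 0.
  apply: (mulfI fgh0); rewrite mulr0 -[RHS](mul0r w) -E mulr_sumr.
  by apply: eq_bigr => i _; rewrite mulrCA.
have Ef : rho f = 1 by rewrite rmorphB !rmorphXn Ey Ez expr1n expr0n gtn_eqF // subr0.
have Eg : rho g = - 'X^n by rewrite rmorphB !rmorphXn Ex Ez expr0n gtn_eqF // sub0r.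
have := congr1 (fun r => (rho r)`_(n * j)) Eq.
rewrite rmorph0 coef0 rmorph_sum coef_sum.
have ltjs : (j < s.+1)%N by [].
have Ei (i : 'I_s.+1) : (rho (nuR i * (f ^+ (s - i) * g ^+ i)))`_(n * j)
    = (-1) ^+ i * (if (i == j :> nat)%N then nu i else 0).
  rewrite !rmorphM !rmorphXn Ef Eg expr1n mul1r rho_nu (exprNn 'X^n) -exprM mulrCA.
  have -> : (-1 : {poly F}) ^+ i = ((-1) ^+ i)%:P by rewrite rmorphXn rmorphN rmorph1.
  rewrite !coefCM coefXn.
  rewrite eqn_pmul2l // eq_sym; congr (_ * _).
  by case: eqP; rewrite ?mulr1 ?mulr0.
under eq_bigr => i _ do rewrite Ei.
rewrite (bigD1 (Ordinal ltjs)) //= eqxx big1 ?addr0 => [|i neq].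
  by move/eqP; rewrite mulf_eq0 signr_eq0 => /eqP.
rewrite (_ : (i == j :> nat) = false) ?mulr0 //.
by apply: contraNF neq => /eqP E'; apply/eqP/val_inj.
Qed.

End Relations.

(** * The descent hypotheses for the polynomial ring *)

Section Reducible.
Variables (K : fieldType) (a b c : 'I_3).
Hypothesis abc : uniq [:: a; b; c].
Variable n : nat.
Hypothesis n_gt0 : (0 < n)%N.

Local Notation R := {mpoly K[3]}.
Local Notation C0 := (@mpolyC 3 K).
Local Notation x := ('X_a : R).
Local Notation y := ('X_b : R).
Local Notation z := ('X_c : R).
Local Notation f := (y ^+ n - z ^+ n).
Local Notation g := (z ^+ n - x ^+ n).
Local Notation h := (x ^+ n - y ^+ n).

Lemma f_neq0 : f != 0.
Proof.
have [Ef _ _] := coord_proj_fgh K abc n_gt0.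
apply/eqP => f0; have /negP := expf_neq0 n (var_neq0 K c); apply.
by rewrite -oppr_eq0 -Ef f0 rmorph0.
Qed.

Lemma coord_reducible : h != 0 -> reducible n x y z.
Proof.
move=> h0; apply: (coef_reduce n_gt0).
  have := @pair_mod_z _ n x y z (subst3 a b C0 x y 0).
  rewrite subst3a (subst3b abc) (subst3c abc); apply => //; last exact: var_neq0.
  have zi : is_ideal (fun r : R => exists r', r = z * r').
    split; first by exists 0; rewrite mulr0.
      by move=> _ _ [p ->] [q ->]; exists (p + q); rewrite mulrDr.
    by move=> d _ [p ->]; exists (d * p); rewrite mulrCA.
  apply: (rmorphism_congr zi) => [d|]; first by rewrite subst3C.
  apply: (vars3_ind abc).
  - by exists 0; rewrite subst3a subrr mulr0.
  - by exists 0; rewrite (subst3b abc) subrr mulr0.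
  - by exists 1; rewrite (subst3c abc) subr0 mulr1.
have Ex : coord_germ K a b c x = 'X * x%:P by apply: subst3a.
have Ey : coord_germ K a b c y = 'X * y%:P by apply: (subst3b abc).
apply: (pair_exp_cancel Ex Ey) => // m r; exact: (coord_pair_exp abc).
Qed.

End Reducible.

Section Main.
Variables (K : fieldType) (a b c : 'I_3).
Hypothesis abc : uniq [:: a; b; c].
Variables (n k : nat) (rs : seq K).
Hypothesis n_ge3 : (3 <= n)%N.
Hypotheses (rs_uniq : uniq rs) (size_rs : size rs = n).
Hypothesis rs_root : all n.-unity_root rs.

Local Notation R := {mpoly K[3]}.
Local Notation C0 := (@mpolyC 3 K).
Local Notation x := ('X_a : R).
Local Notation y := ('X_b : R).
Local Notation z := ('X_c : R).
Local Notation f := (y ^+ n - z ^+ n).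
Local Notation g := (z ^+ n - x ^+ n).
Local Notation h := (x ^+ n - y ^+ n).

Let n_gt0 : (0 < n)%N := ltnW (ltnW n_ge3).
Let bca := uniq3_rot abc.
Let cab := uniq3_rot bca.

Lemma coord_independent (S : R -> Prop) i j : (0 < i <= k)%N -> (j < n)%N ->
  (forall s, S s -> [\/ exists t, s = h ^+ (k - i).+1 * t,
     exists2 e, (n * (k * n + i) < e)%N & homdeg e s |
     exists2 l, (l < n)%N && (l != j) &
       s = coord_coef n k x y z i * (x ^+ (n - 1 - l) * y ^+ l)]) ->
  ~ ideal_gen S (coord_coef n k x y z i * (x ^+ (n - 1 - j) * y ^+ j)).
Proof.
move=> ltik ltjn S_cases Sj.
have le_ord (l : 'I_n) : (l <= n - 1)%N.
  by rewrite subn1 -ltnS prednK.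
pose B l : R := coord_coef n k x y z i * (x ^+ (n - 1 - l) * y ^+ l).
have HB l : (l < n)%N -> homdeg (n * (k * n + i)) (B l).
  move=> ltl; apply: homdeg_coord_coef => //; try exact: homdegX.
  by rewrite subn1 -ltnS prednK.
have HH : exists e, homdeg e (h ^+ (k - i).+1).
  by eexists; apply/homdeg_exp/homdeg_subX; exact: homdegX.
have [nu [w [nuj E]]] := homdeg_independent ltjn HB HH S_cases Sj.
have nu0 l : (l < n)%N -> (nu l)%:MP = 0 :> R.
  (* At y = zeta x the l-th monomial becomes zeta^l x^(n-1), while h vanishes and f becomes -g,
     which is nonzero. *)
  move: l; apply: (coef_extract rs_uniq size_rs) => zeta zrs.
  pose psi := subst3 a b C0 x (zeta%:MP * x) z.
  have px : psi x = x by rewrite /psi subst3a.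
  have py : psi y = zeta%:MP * x by rewrite /psi (subst3b abc).
  have pz : psi z = z by rewrite /psi (subst3c abc).
  have pyn : psi y ^+ n = x ^+ n by rewrite py (root_mul_expn rs_root).
  have g0 := f_neq0 K bca n_gt0.
  have pf : psi f = - g by rewrite rmorphB !rmorphXn pyn pz opprB.
  have pg : psi g = g by rewrite rmorphB !rmorphXn px pz.
  have ph : psi h = 0 by rewrite rmorphB !rmorphXn pyn px subrr.
  have f0' : psi f != 0 by rewrite pf oppr_eq0.
  have g0' : psi g != 0 by rewrite pg.
  have x0' : psi x != 0 by rewrite px var_neq0.
  have := @coord_relation _ n k x y z _ psi i (fun l => (nu l)%:MP) w
    (f_neq0 K cab n_gt0) f0' g0' ph x0' E.
  rewrite px py => E0.
  apply: (mulfI (expf_neq0 (n - 1) (var_neq0 K a))); rewrite mulr0 -[RHS]E0 mulr_sumr.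
  by apply: eq_bigr => l _; rewrite /psi subst3C; apply/mul_form_monomial/le_ord.
by have /eqP := nu0 j ltjn; rewrite mpolyC_eq0 nuj oner_eq0.
Qed.

(** These generators have the lowest degree and the coordinate families lie strictly above, so the
    relation is exact and [H] is 0. *)
Lemma base_independent (S : R -> Prop) j : (j <= (n - 3) * k)%N ->
  (forall s, S s -> [\/ exists t, s = 0 * t,
     exists2 e, (n * (k * n) < e)%N & homdeg e s |
     exists2 l, (l < ((n - 3) * k).+1)%N && (l != j) &
       s = (f * g * h) ^+ k * (f ^+ ((n - 3) * k - l) * g ^+ l)]) ->
  ~ ideal_gen S ((f * g * h) ^+ k * (f ^+ ((n - 3) * k - j) * g ^+ j)).
Proof.
move=> lej S_cases Sj.
pose B l : R := (f * g * h) ^+ k * (f ^+ ((n - 3) * k - l) * g ^+ l).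
have HB l : (l < ((n - 3) * k).+1)%N -> homdeg (n * (k * n)) (B l).
  by move=> ltl; apply: homdeg_base => //; exact: homdegX.
have HH : exists e, homdeg e (0 : R) by exists 0%N; exact: homdeg0.
have ltj : (j < ((n - 3) * k).+1)%N by [].
have [nu [w [nuj E]]] := homdeg_independent ltj HB HH S_cases Sj.
pose rho := subst3 a b (@polyC K) 'X 1 0.
have rx : rho x = 'X by rewrite /rho subst3a.
have ry : rho y = 1 by rewrite /rho (subst3b abc).
have rz : rho z = 0 by rewrite /rho (subst3c abc).
have rnu l : rho (nu l)%:MP = (nu l)%:P by rewrite /rho subst3C.
have := @base_relation _ n k x y z _ rho ((n - 3) * k) nu (fun l => (nu l)%:MP) w
  n_gt0 (f_neq0 K abc n_gt0) (f_neq0 K bca n_gt0)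
  (f_neq0 K cab n_gt0) rx ry rz rnu E j lej.
by rewrite nuj => /eqP; rewrite oner_eq0.
Qed.

Lemma symbolic_fermatE :
  ideal_eq (ideal_of_seq (fermat_gens n k x y z)) (symbolic_power (fermat n x y z) (k * n)).
Proof.
move=> r; split=> [/(gens_pair n_ge3)[fg_r xy_r yz_r zx_r]|sym_r].
  exact: (mem_symbolic abc n_gt0 rs_uniq size_rs rs_root fg_r xy_r yz_r zx_r).
have red_x := coord_reducible abc n_gt0 (f_neq0 K cab n_gt0).
have red_y := coord_reducible bca n_gt0 (f_neq0 K abc n_gt0).
have red_z := coord_reducible cab n_gt0 (f_neq0 K bca n_gt0).
apply: (gens_generation n_ge3 red_x red_y red_z).
- exact: (symbolic_points abc n_gt0 rs_uniq size_rs rs_root sym_r).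
- exact: (symbolic_coord abc n_gt0 sym_r).
- by apply: (symbolic_coord bca n_gt0 (m := k * n)); rewrite fermat_rot.
- apply: (symbolic_coord cab n_gt0 (m := k * n)).
  by rewrite (fermat_rot n y z x) (fermat_rot n x y z).
Qed.

End Main.

Section Minimality.
Variables (K : fieldType) (a b c : 'I_3).
Hypothesis abc : uniq [:: a; b; c].
Variables (n k : nat) (rs : seq K).
Hypothesis n_ge3 : (3 <= n)%N.
Hypotheses (rs_uniq : uniq rs) (size_rs : size rs = n).
Hypothesis rs_root : all n.-unity_root rs.

Local Notation R := {mpoly K[3]}.
Local Notation x := ('X_a : R).
Local Notation y := ('X_b : R).
Local Notation z := ('X_c : R).
Local Notation gen := (gen n k x y z).

Let bca := uniq3_rot abc.
Let cab := uniq3_rot bca.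

Lemma homdeg_gen t i j : (t, i, j) \in gen_idx n k ->
  homdeg (n * (k * n + i)) (gen (t, i, j)).
Proof.
have X l : homdeg 1 ('X_l : R) := homdegX K l.
rewrite mem_gen_idx; case: t => [|[|[|[|t]]]] //.
- by case/andP=> /eqP-> lej; rewrite addn0; apply: homdeg_base.
- by case/and3P=> _ ltik lej; apply: homdeg_coord_coef.
- by case/and3P=> _ ltik lej; apply: homdeg_coord_coef.
- by case/and3P=> _ ltik lej; apply: homdeg_coord_coef.
Qed.

(** Against a generator of level i, higher levels have larger degree. Among levels at most i, the
    generators of other families and those of lower level are divisible by the relevant power of h
    (or of its rotation), and only siblings at level i remain. *)
Lemma gen_independent p : p \in gen_idx n k ->
  ~ ideal_gen (fun r => exists q, [/\ q \in gen_idx n k, q != p & r = gen q]) (gen p).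
Proof.
have n_gt0 : (0 < n)%N by lia.
have ltn_deg i i' : (i < i')%N -> (n * (k * n + i) < n * (k * n + i'))%N.
  by move=> lt; rewrite ltn_pmul2l // ltn_add2l.
have dvd0 := @base_dvdS R n k x y z n_ge3.
have dvd1 := @coord_coef_dvdS R n k x y z n_ge3.
have dvd2 := @coord_coef_dvdS R n k y z x n_ge3.
have dvd3 := @coord_coef_dvdS R n k z x y n_ge3.
pose u0 j : R := (y ^+ n - z ^+ n) ^+ ((n - 3) * k - j) * (z ^+ n - x ^+ n) ^+ j.
pose mon (u v : R) j := u ^+ (n - 1 - j) * v ^+ j.
case: p => [[t i] j]; rewrite mem_gen_idx.
case: t => [/andP[/eqP-> lej]|[/and3P[_ ltik lej]|[/and3P[_ ltik lej]|
  [/and3P[_ ltik lej]|//]]]].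
- apply: (base_independent abc) => // _ [[[t i'] j'] [qidx neq ->]].
  have := homdeg_gen qidx; move: (qidx) neq; rewrite mem_gen_idx.
  case: t qidx => [|t] qidx.
    case/andP=> /eqP-> lej' neq _; apply: Or33; exists j' => //.
    rewrite ltnS lej' /=; apply: contraNneq neq => ->; exact: eqxx.
  case/and3P=> _ /andP[i'_gt0 _] _ _ Hd; apply: Or32; eexists; last exact: Hd.
  by rewrite ltn_pmul2l // -[X in (X < _)%N]addn0 ltn_add2l.
- apply: (coord_independent abc n_ge3 rs_uniq size_rs rs_root ltik)
    => [|_ [[[t i'] j'] [qidx neq ->]]]; first by lia.
  have Hd := homdeg_gen qidx.
  have [lti|leii] := ltnP i i'.
    by apply: Or32; eexists; [apply: ltn_deg lti | exact: Hd].
  move: qidx neq; rewrite mem_gen_idx.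
  case: t Hd => [|[|[|[|t]]]] // _.
  + by move=> _ _; apply: Or31; have [_ _ H] := dvd0 i (u0 j') ltik; exact: H.
  + move=> /and3P[_ /andP[_ lei'k] lej'] neq.
    move: leii; rewrite leq_eqVlt => /orP[/eqP Ei|lti].
      apply: Or33; exists j'; last by rewrite Ei.
      apply/andP; split; first by lia.
      by apply: contraNneq neq => Ej; rewrite Ei Ej eqxx.
    have [_ _ H] := dvd1 i i' (mon x y j') ltik lei'k.
    by apply: Or31; exact: H.
  + move=> /and3P[_ /andP[_ lei'k] _] _; apply: Or31.
    by have [_ H _] := dvd2 i i' (mon y z j') ltik lei'k; exact: H.
  + move=> /and3P[_ /andP[_ lei'k] _] _; apply: Or31.
    by have [H _ _] := dvd3 i i' (mon z x j') ltik lei'k; exact: H.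
- apply: (coord_independent bca n_ge3 rs_uniq size_rs rs_root ltik)
    => [|_ [[[t i'] j'] [qidx neq ->]]]; first by lia.
  have Hd := homdeg_gen qidx.
  have [lti|leii] := ltnP i i'.
    by apply: Or32; eexists; [apply: ltn_deg lti | exact: Hd].
  move: qidx neq; rewrite mem_gen_idx.
  case: t Hd => [|[|[|[|t]]]] // _.
  + by move=> _ _; apply: Or31; have [H _ _] := dvd0 i (u0 j') ltik; exact: H.
  + move=> /and3P[_ /andP[_ lei'k] _] _; apply: Or31.
    by have [H _ _] := dvd1 i i' (mon x y j') ltik lei'k; exact: H.
  + move=> /and3P[_ /andP[_ lei'k] lej'] neq.
    move: leii; rewrite leq_eqVlt => /orP[/eqP Ei|lti].
      apply: Or33; exists j'; last by rewrite Ei.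
      apply/andP; split; first by lia.
      by apply: contraNneq neq => Ej; rewrite Ei Ej eqxx.
    have [_ _ H] := dvd2 i i' (mon y z j') ltik lei'k.
    by apply: Or31; exact: H.
  + move=> /and3P[_ /andP[_ lei'k] _] _; apply: Or31.
    by have [_ H _] := dvd3 i i' (mon z x j') ltik lei'k; exact: H.
- apply: (coord_independent cab n_ge3 rs_uniq size_rs rs_root ltik)
    => [|_ [[[t i'] j'] [qidx neq ->]]]; first by lia.
  have Hd := homdeg_gen qidx.
  have [lti|leii] := ltnP i i'.
    by apply: Or32; eexists; [apply: ltn_deg lti | exact: Hd].
  move: qidx neq; rewrite mem_gen_idx.
  case: t Hd => [|[|[|[|t]]]] // _.
  + by move=> _ _; apply: Or31; have [_ H _] := dvd0 i (u0 j') ltik; exact: H.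
  + move=> /and3P[_ /andP[_ lei'k] _] _; apply: Or31.
    by have [_ H _] := dvd1 i i' (mon x y j') ltik lei'k; exact: H.
  + move=> /and3P[_ /andP[_ lei'k] _] _; apply: Or31.
    by have [H _ _] := dvd2 i i' (mon y z j') ltik lei'k; exact: H.
  + move=> /and3P[_ /andP[_ lei'k] lej'] neq.
    move: leii; rewrite leq_eqVlt => /orP[/eqP Ei|lti].
      apply: Or33; exists j'; last by rewrite Ei.
      apply/andP; split; first by lia.
      by apply: contraNneq neq => Ej; rewrite Ei Ej eqxx.
    have [_ _ H] := dvd3 i i' (mon z x j') ltik lei'k.
    by apply: Or31; exact: H.
Qed.

End Minimality.

Theorem theorem3p6 (n k : nat) (hn : (3 <= n)%N) (hk : (1 <= k)%N)
    (K : fieldType)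
    (hK : exists rs : n.-tuple K, uniq rs /\ all n.-unity_root rs) :
  let x : {mpoly K[3]} := 'X_0 in
  let y : {mpoly K[3]} := 'X_1 in
  let z : {mpoly K[3]} := 'X_2 in
  let f := y ^+ n - z ^+ n in
  let g := z ^+ n - x ^+ n in
  let h := x ^+ n - y ^+ n in
  let I := ideal_of_seq [:: x * f; y * g; z * h] in
  let c1 i := f ^+ ((k - i) * (n - 2) + 2 * i) * g ^+ (k + i * (n - 3))
              * h ^+ (k - i) * x ^+ ((i - 1) * n + 1) in
  let c2 i := f ^+ (k - i) * g ^+ ((k - i) * (n - 2) + 2 * i)
              * h ^+ (k + i * (n - 3)) * y ^+ ((i - 1) * n + 1) in
  let c3 i := f ^+ (k + i * (n - 3)) * g ^+ (k - i)
              * h ^+ ((k - i) * (n - 2) + 2 * i) * z ^+ ((i - 1) * n + 1) in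
  let term c a b s :=
    ideal_mul (ideal_of_seq [:: c]) (ideal_exp (ideal_of_seq [:: a; b]) s) in
  let sum_terms c a b :=
    \big[@ideal_add _/@ideal0 _]_(1 <= i < k.+1) term (c i) a b (n - 1)%N in
  let gens :=
    [seq (f * g * h) ^+ k * u | u <- pow_gens f g ((n - 3) * k)]
    ++ [seq c1 i * u | i <- iota 1 k, u <- pow_gens x y (n - 1)]
    ++ [seq c2 i * u | i <- iota 1 k, u <- pow_gens y z (n - 1)]
    ++ [seq c3 i * u | i <- iota 1 k, u <- pow_gens z x (n - 1)] in
  ideal_eq (symbolic_power I (k * n))
    (ideal_add (term ((f * g * h) ^+ k) f g ((n - 3) * k)%N)
      (ideal_add (sum_terms c1 x y)
        (ideal_add (sum_terms c2 y z) (sum_terms c3 z x))))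
  /\ minimal_generators gens (symbolic_power I (k * n)).
Proof.
move=> x y z f g h I c1 c2 c3 term sum_terms gens.
have [rs [rs_uniq rs_root]] := hK.
have abc : uniq [:: 0; 1; 2 : 'I_3] by [].
have size_rs : size rs = n := size_tuple rs.
have symE := symbolic_fermatE abc k hn rs_uniq size_rs rs_root.
split=> [r|].
  by split=> [/symE/fermat_sumE|/fermat_sumE/symE].
(* The list of the statement is exchanged by conversion for its indexed form. *)
rewrite -[gens]/(fermat_gens n k x y z) fermat_gensE.
apply: minimal_generators_indep; first exact: gen_idx_uniq.
  by rewrite -fermat_gensE.
move=> p; exact: (gen_independent abc hn rs_uniq size_rs rs_root).
Qed.
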